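(* Let $t\le r$ and $\sigma^2>0$, and let $\mathbf H$ be an $r\times t$ random matrix with i.i.d. circularly symmetric $CN(0,1)$ entries. Then the quantities $\delta^*=E\{\ln\det(\frac{\mathbf H^\dagger\mathbf H}{\pi e\sigma^2})\}$ and $V=t+\mathrm{Var}(\ln\det(\mathbf H^\dagger\mathbf H))$ (the Poltyrev capacity and channel dispersion of the $t\times r$ MIMO fast fading channel with noise $CN(0,\sigma^2I_r)$ under full dimensional transmission) equal $$\delta^*=-\gamma t+1-t+t\sum_{p=1}^{r-t}\frac1p+r\sum_{p=r-t+1}^{r-1}\frac1p-t\ln(\pi e\sigma^2),$$ $$V=t+\frac{\pi^2t}{6}-t\sum_{p=1}^{r-t}\frac1{p^2}-\sum_{p=r-t+1}^{r-1}\frac{r-p}{p^2},$$ where $\gamma=0.577\ldots$ is Euler's constant.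
   Context: Empty sums are zero. *)

(* Defs.v *)
From HB Require Import structures.
From mathcomp Require Import all_boot all_order all_algebra.
From mathcomp Require Import all_classical all_reals all_analysis.
From mathcomp Require Import complex.
Set Implicit Arguments. Unset Strict Implicit. Unset Printing Implicit Defensive.
Import Order.TTheory GRing.Theory Num.Theory.
Local Open Scope classical_set_scope.
Local Open Scope ring_scope.

Definition euler_gamma (R : realType) : R :=
  limn (fun n : nat => \sum_(1 <= k < n.+1) (k%:R : R)^-1 - ln (n%:R : R)).

Definition mutually_independent {d} {T : measurableType d} {R : realType}
  (P : probability T R) {I : finType} (X : I -> T -> R) : Prop :=
  forall B : I -> set R, (forall i, measurable (B i)) ->
  P (\bigcap_(i in [set: I]) (X i @^-1` B i)) =
  (\prod_(i : I) P (X i @^-1` B i))%E.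

Definition ctrmx {R : rcfType} {m n : nat} (H : 'M[R[i]]_(m, n)) : 'M[R[i]]_(n, m) :=
  \matrix_(i, j) (H j i)^*.

Definition cmatrix {R : realType} {T : Type} {r t : nat}
  (X : 'I_r -> 'I_t -> bool -> T -> R) (w : T) : 'M[R[i]]_(r, t) :=
  \matrix_(i, j) (X i j false w +i* X i j true w)%C.

(* ln det of a Hermitian matrix (its determinant is real) *)
Definition lndet {R : realType} {n : nat} (A : 'M[R[i]]_n) : R :=
  ln (complex.Re (\det A)).

(* Main.v *)
(* A unitary matrix depending only on the first column of H rotates that column
   onto the first axis and leaves the remaining columns i.i.d. Gaussian. Hence
   det(H^dagger H) has the law of the product of a Gamma(r) variable, the squared
   norm of the first column, and an independent determinant of the same kind for
   an (r-1) x (t-1) matrix. Instead of adding independent variables, the induction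
   tracks the numbers E (ln det(H^dagger H) - a)^2 for all real a, which determine
   both mean and variance and are preserved by conditioning on the first column.

   For a Gamma variable G_n of shape n+1, integration by parts gives
     E (ln G_n - a)^2 = 1/(n+1)^2 + E (ln G_(n+1) - a - 1/(n+1))^2.
   As ln G_n concentrates at ln n, the limit of the iterates is expressed through
   the sum of the 1/k^2 and Euler's constant. *)

Require Import Defs.
From HB Require Import structures.
From mathcomp Require Import all_boot all_order all_algebra.
From mathcomp Require Import all_classical all_reals all_analysis measurable_realfun.
From mathcomp Require Import complex ring lra zify.
Import Order.TTheory GRing.Theory Num.Theory.
Import numFieldNormedType.Exports.
Set Implicit Arguments. Unset Strict Implicit. Unset Printing Implicit Defensive.
Local Open Scope classical_set_scope.
Local Open Scope ring_scope.

(** * Planar Gaussian and Gamma integrals *)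

(** Squared distances are nonnegative, so Tonelli and monotone convergence apply throughout with
    values in [0, +oo]; square integrability of the logarithm is an outcome of the computation, not
    an input. The mean is then recovered by comparing the values at a = 0 and a = 1. Gaussian
    families are compared only through probabilities of rectangles, on arbitrary probability spaces,
    and independence is realized by passing to a product space. Unitary invariance reduces to
    rotations of the plane, and these to shears. Since [ln] vanishes on nonpositive arguments, ln (x
    D) splits as a sum only where D > 0; the null set D <= 0 is therefore carried through the
    induction along with the moments. The Gamma recursion can be closed because ln^2 u <= u + 1/u -
    2, whose expectation at u = G / M is explicit and of order 1/M. The constant pi^2 / 6 is the
    Basel sum, proved below by halving angles. *)

Section density.
Local Open Scope ereal_scope.
Context d (T : measurableType d) (R : realType).
Context (mu nu : {measure set T -> \bar R}) (w : T -> R).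
Context (mw : measurable_fun setT w) (w0 : forall x, (0 <= w x)%R).
Context (nuE : forall A, measurable A -> nu A = \int[mu]_(x in A) (w x)%:E).

Import HBNNSimple.

Let integral_density_nnsfun (f : {nnsfun T >-> R}) :
  \int[nu]_x (f x)%:E = \int[mu]_x ((f x)%:E * (w x)%:E).
Proof.
under [LHS]eq_integral do rewrite fimfunE -fsumEFin//.
rewrite [LHS]ge0_integral_fsum//; last 2 first.
  - by move=> r; exact/measurable_EFinP/measurableT_comp.
  - by move=> n x _; rewrite EFinM nnfun_muleindic_ge0.
under [RHS]eq_integral.
  move=> x xD; rewrite fimfunE -fsumEFin// ge0_mule_fsuml; last first.
    by move=> r; rewrite EFinM nnfun_muleindic_ge0.
  over.
rewrite [RHS]ge0_integral_fsum//; last 2 first.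
  - move=> r; apply: emeasurable_funM => //; last exact/measurable_EFinP.
    by apply/measurable_EFinP; do 2 apply/measurableT_comp => //.
  - by move=> n x _; apply: mule_ge0; [rewrite EFinM nnfun_muleindic_ge0|rewrite lee_fin].
apply: eq_fsbigr => r _.
rewrite integralZl_indic_nnsfun// integral_indic// setIT nuE//.
have [r0|r0] := ltP r 0%R.
  rewrite preimage_nnfun0// integral_set0 mule0.
  by under eq_integral do rewrite indic0 mulr0 mul0e; rewrite integral0.
under [RHS]eq_integral do rewrite EFinM -muleA.
rewrite ge0_integralZl_EFin//; last 2 first.
  by move=> x _; rewrite mule_ge0 ?lee_fin.
  by apply: emeasurable_funM => //; [exact/measurable_EFinP/measurable_indic|exact/measurable_EFinP].
congr (_ * _); rewrite integral_mkcond; apply: eq_integral => x _.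
by rewrite patchE indicE; case: ifPn => _; rewrite ?mul1e ?mul0e.
Qed.

(** Simple functions, then monotone convergence. The density [w] will be [normal_pdf], or the
    indicator of a half-line when Lebesgue measure is restricted. *)
Lemma ge0_integral_density (f : T -> \bar R) :
  measurable_fun setT f -> (forall x, 0 <= f x) ->
  \int[nu]_x f x = \int[mu]_x (f x * (w x)%:E).
Proof.
move=> mf f0.
pose f_ := nnsfun_approx measurableT mf.
transitivity (limn (fun n => \int[nu]_x (f_ n x)%:E)).
  rewrite -monotone_convergence//=.
  - apply: eq_integral => ? /[!inE] xD; apply/esym/cvg_lim => //=.
    exact: cvg_nnsfun_approx.
  - by move=> n; exact/measurable_EFinP/measurable_funTS.
  - by move=> n ? _; rewrite lee_fin.
  - by move=> ? _ ? ? mn; rewrite lee_fin; exact/lefP/nd_nnsfun_approx.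
under eq_fun do rewrite integral_density_nnsfun.
rewrite -monotone_convergence//=.
- apply: eq_integral => x _; apply/cvg_lim => //.
  rewrite muleC; under eq_fun do rewrite muleC.
  by apply: cvgeMl => //; exact: cvg_nnsfun_approx.
- move=> n; apply: emeasurable_funM => //; last exact/measurable_EFinP.
  exact/measurable_EFinP/measurable_funTS.
- by move=> n x _; rewrite mule_ge0 ?lee_fin.
- move=> x _ m n mn; rewrite lee_pmul// ?lee_fin//.
  exact/lefP/nd_nnsfun_approx.
Qed.

End density.

Lemma measure_integral_indic d (T : measurableType d) (R : realType)
    (m : {measure set T -> \bar R}) (A : set T) :
  measurable A -> m A = (\int[m]_x (\1_A x)%:E)%E.
Proof. by move=> mA; rewrite integral_indic// setIT. Qed.

(** Names the bundled measure structure of the pushforward, so that uniqueness theorems for measures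
    can be applied to it. *)
Definition image_measure d d' (T1 : measurableType d) (T2 : measurableType d')
    (R : realType) (m : {measure set T1 -> \bar R}) (f : T1 -> T2)
    (mf : measurable_fun setT f) : {measure set T2 -> \bar R} :=
  measure_function_pushforward__canonical__measure_function_Measure m mf.

Lemma ge0_integral_image_measure d d' (T1 : measurableType d) (T2 : measurableType d')
    (R : realType) (m : {measure set T1 -> \bar R}) (phi : T1 -> T2)
    (mphi : measurable_fun setT phi) (f : T2 -> \bar R) :
  measurable_fun setT f -> (forall x, 0 <= f x)%E ->
  (\int[image_measure m mphi]_x f x = \int[m]_x f (phi x))%E.
Proof. by move=> mf f0; rewrite ge0_integral_pushforward. Qed.

Section lebesgue_affine.
Local Open Scope ereal_scope.
Context {R : realType}.
Local Notation mu := (@lebesgue_measure R).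

(** The image of Lebesgue measure under the translation gives half-open intervals their length, and
    this characterizes Lebesgue measure. *)
Lemma ge0_integral_translate (c : R) (f : R -> \bar R) :
  measurable_fun setT f -> (forall x, 0 <= f x) ->
  \int[mu]_x f (x + c)%R = \int[mu]_x f x.
Proof.
move=> mf f0.
have mm : @measurable_fun _ _ (measurableTypeR R) (measurableTypeR R) setT (fun x => x + c)%R.
  exact: measurable_funD.
rewrite -(ge0_integral_image_measure mu mm)//.
apply: eq_measure_integral => A mA _; apply/esym.
apply: (@lebesgue_measure_unique _ (image_measure mu mm)) => // _ [[a b]] _ <-.
rewrite [RHS](_ : _ = mu `](a - c)%R, (b - c)%R]%classic); last first.
  congr (mu _).
  by apply/seteqP; split => x /=; rewrite !in_itv/= ltrBlDr lerBrDr.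
rewrite !lebesgue_measure_itv/= !lte_fin ltrD2r; case: ifPn => // _.
by rewrite -!EFinB; congr (_%:E); ring.
Qed.

Lemma ge0_integral_scale (c : R) (f : R -> \bar R) : (0 < c)%R ->
  measurable_fun setT f -> (forall x, 0 <= f x) ->
  \int[mu]_x f (c * x)%R = c^-1%:E * \int[mu]_x f x.
Proof.
move=> c0 mf f0.
have mm : @measurable_fun _ _ (measurableTypeR R) (measurableTypeR R) setT (fun x => c * x)%R.
  exact: measurable_funM.
(* In this form the claim is that [c] times the image measure is Lebesgue measure, which can be
   tested on intervals. *)
suff -> : \int[mu]_x f x = c%:E * \int[mu]_x f (c * x)%R.
  by rewrite muleA -EFinM mulVf ?gt_eqF// mul1e.
pose k : {nonneg R} := NngNum (ltW c0).
rewrite -(ge0_integral_image_measure mu mm)//.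
rewrite -(ge0_integral_mscale (image_measure mu mm) measurableT k)//.
apply: eq_measure_integral => A mA _.
apply: (@lebesgue_measure_unique _ (mscale k (image_measure mu mm))) => // _ [[a b]] _ <-.
rewrite [RHS](_ : _ = c%:E * mu `](a / c)%R, (b / c)%R]%classic); last first.
  congr (_ * mu _).
  by apply/seteqP; split => x /=; rewrite !in_itv/= ltr_pdivrMr// ler_pdivlMr// ![(x * c)%R]mulrC.
rewrite !lebesgue_measure_itv/= !lte_fin ltr_pM2r ?invr_gt0//; case: ifPn => // _; last by rewrite mule0.
by rewrite -!EFinB -EFinM; congr (_%:E); rewrite -mulrBl mulrCA divff ?mulr1// gt_eqF.
Qed.

End lebesgue_affine.

(** * Rotation invariance of the planar Gaussian law *)

Section gauss2.
Local Open Scope ereal_scope.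
Context {R : realType}.
Local Notation mu := (@lebesgue_measure R).
Local Notation N := (@normal_prob R 0 (Num.sqrt 2^-1)).

(** The density of CN(0,1) on the plane: real and imaginary parts have variance 1/2 each, hence the
    standard deviation [Num.sqrt 2^-1] everywhere below. *)
Definition gauss2_pdf (z : R * R) : R := (expR (- (z.1 ^+ 2 + z.2 ^+ 2)) / pi)%R.

Lemma gauss2_pdf_ge0 z : (0 <= gauss2_pdf z)%R.
Proof. by rewrite divr_ge0 ?expR_ge0 ?pi_ge0. Qed.

Lemma measurable_gauss2_pdf : measurable_fun setT gauss2_pdf.
Proof.
apply: measurable_funM => //; apply: measurableT_comp => //.
apply: measurableT_comp => //.
by apply: measurable_funD; apply: measurable_funX; [exact: measurable_fst|exact: measurable_snd].
Qed.

Lemma normal_pdf_half x :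
  normal_pdf 0 (Num.sqrt 2^-1) x = (expR (- x ^+ 2) / Num.sqrt (@pi R))%R.
Proof.
have h : (Num.sqrt 2^-1 ^+ 2 = 2^-1 :> R)%R by rewrite sqr_sqrtr.
rewrite normal_pdfE ?gt_eqF ?sqrtr_gt0//.
rewrite /normal_peak /normal_fun h subr0 mulrC -[(2^-1 *+ 2)%R]mulr_natr mulVf ?pnatr_eq0// divr1.
by congr (_ / Num.sqrt _)%R; rewrite -mulr_natr; field.
Qed.

Lemma ge0_integral_gauss2 (f : R * R -> \bar R) :
  measurable_fun setT f -> (forall z, 0 <= f z) ->
  \int[(N \x N)]_z f z = \int[(mu \x mu)]_z (f z * (gauss2_pdf z)%:E).
Proof.
move=> mf f0.
have mpdf : measurable_fun setT (normal_pdf 0 (Num.sqrt 2^-1) : R -> R).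
  exact: measurable_normal_pdf.
rewrite fubini_tonelli1//= (ge0_integral_density (mu := mu) mpdf)//; last 3 first.
- by move=> x; exact: normal_pdf_ge0.
- exact: measurable_fun_fubini_tonelli_F.
- by move=> x; apply: integral_ge0.
rewrite fubini_tonelli1/=; last 2 first.
- by apply: emeasurable_funM => //; apply/measurable_EFinP; exact: measurable_gauss2_pdf.
- by move=> z; rewrite mule_ge0// lee_fin gauss2_pdf_ge0.
apply: eq_integral => x _; rewrite /fubini_F.
have mfx : measurable_fun setT (fun y => f (x, y)) by exact: measurableT_comp.
rewrite (ge0_integral_density (mu := mu) mpdf)//; last by move=> y; exact: normal_pdf_ge0.
rewrite muleC -ge0_integralZl//; last 3 first.
- by apply: emeasurable_funM => //; exact/measurable_EFinP.
- by move=> y _; rewrite mule_ge0// lee_fin normal_pdf_ge0.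
- by rewrite lee_fin normal_pdf_ge0.
apply: eq_integral => y _; rewrite muleCA; congr (_ * _).
rewrite -EFinM; congr (_%:E).
rewrite !normal_pdf_half /gauss2_pdf/= opprD expRD mulrACA -invfM -expr2 sqr_sqrtr//.
exact: pi_ge0.
Qed.

(* A rotation is a product of three shears, and Lebesgue measure is invariant
   under each of them by Tonelli and translation invariance. *)
Lemma ge0_integral_shear1 (a : R) (f : R * R -> \bar R) :
  measurable_fun setT f -> (forall z, 0 <= f z) ->
  \int[(mu \x mu)]_z f (z.1 + a * z.2, z.2)%R = \int[(mu \x mu)]_z f z.
Proof.
move=> mf f0.
have mg : measurable_fun setT (fun z : R * R => f (z.1 + a * z.2, z.2)%R).
  apply: measurableT_comp => //; apply/measurable_fun_pairP; split; last exact: measurable_snd.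
  by apply: measurable_funD => //; apply: measurable_funM.
apply: (eq_trans (@fubini_tonelli2 _ _ (measurableTypeR R) (measurableTypeR R) R mu mu _ mg (fun z => f0 _))).
apply: (eq_trans _ (esym (@fubini_tonelli2 _ _ (measurableTypeR R) (measurableTypeR R) R mu mu _ mf f0))).
apply: eq_integral => y _; rewrite /fubini_G/=.
rewrite (ge0_integral_translate (a * y) (f := fun x => f (x, y)))//.
exact: measurableT_comp.
Qed.

Lemma ge0_integral_shear2 (a : R) (f : R * R -> \bar R) :
  measurable_fun setT f -> (forall z, 0 <= f z) ->
  \int[(mu \x mu)]_z f (z.1, z.2 + a * z.1)%R = \int[(mu \x mu)]_z f z.
Proof.
move=> mf f0.
have mg : measurable_fun setT (fun z : R * R => f (z.1, z.2 + a * z.1)%R).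
  apply: measurableT_comp => //; apply/measurable_fun_pairP; split; first exact: measurable_fst.
  by apply: measurable_funD => //; apply: measurable_funM.
apply: (eq_trans (@fubini_tonelli1 _ _ (measurableTypeR R) (measurableTypeR R) R mu mu _ mg (fun z => f0 _))).
apply: (eq_trans _ (esym (@fubini_tonelli1 _ _ (measurableTypeR R) (measurableTypeR R) R mu mu _ mf f0))).
apply: eq_integral => y _; rewrite /fubini_F/=.
rewrite (ge0_integral_translate (a * y) (f := fun x => f (y, x)))//.
exact: measurableT_comp.
Qed.

Definition rot2 (c s : R) (z : R * R) : R * R :=
  (c * z.1 + s * z.2, - s * z.1 + c * z.2)%R.

Lemma measurable_rot2 c s : measurable_fun setT (rot2 c s).
Proof.
apply/measurable_fun_pairP; split => //=;
  by apply: measurable_funD => //; apply: measurable_funM.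
Qed.

Let ge0_integral_rot2_lebesgue c s (f : R * R -> \bar R) :
  (c != -1)%R -> (c ^+ 2 + s ^+ 2 = 1)%R ->
  measurable_fun setT f -> (forall z, 0 <= f z) ->
  \int[(mu \x mu)]_z f (rot2 c s z) = \int[(mu \x mu)]_z f z.
Proof.
move=> c1 cs mf f0.
have c10 : (1 + c != 0)%R by rewrite addrC addr_eq0.
(* For c = cos theta and s = sin theta this is tan (theta / 2), the shear parameter of the rotation;
   it exists unless c = -1. *)
pose t := (s / (1 + c))%R.
have e1 z : rot2 c s z = let z1 := (z.1 + t * z.2, z.2)%R in
   let z2 := (z1.1, z1.2 + (- s) * z1.1)%R in (z2.1 + t * z2.2, z2.2)%R.
  have tc : (t * (1 + c) = s)%R by rewrite /t divfK.
  have ts : (t * s = 1 - c)%R.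
    have ss : (s ^+ 2 = 1 - c ^+ 2)%R by rewrite -cs addrAC subrr add0r.
    rewrite /t mulrAC -expr2 (_ : s ^+ 2 = (1 - c) * (1 + c))%R ?mulfK//.
    by rewrite ss; ring.
  rewrite /rot2/=; congr pair.
    transitivity ((1 - t * s) * z.1 + t * (1 + (1 - t * s)) * z.2)%R; last by ring.
    by rewrite ts (_ : 1 - (1 - c) = c)%R ?tc//; ring.
  transitivity (- s * z.1 + (1 - t * s) * z.2)%R; last by ring.
  by rewrite ts; ring.
under eq_integral do rewrite e1/=.
pose g1 := (fun z => f (z.1 + t * z.2, z.2)%R) : R * R -> \bar R.
pose g2 := (fun z => g1 (z.1, z.2 + (- s) * z.1)%R) : R * R -> \bar R.
have m1 : measurable_fun setT g1.
  apply: measurableT_comp => //; apply/measurable_fun_pairP; split; last exact: measurable_snd.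
  by apply: measurable_funD => //; apply: measurable_funM.
have m2 : measurable_fun setT g2.
  apply: measurableT_comp => //; apply/measurable_fun_pairP; split; first exact: measurable_fst.
  by apply: measurable_funD => //; apply: measurable_funM.
rewrite -(ge0_integral_shear1 t mf f0).
rewrite -(@ge0_integral_shear2 (- s)%R g1)//; last by move=> z; exact: f0.
by rewrite -(@ge0_integral_shear1 t g2)// => z; exact: f0.
Qed.

Lemma ge0_integral_rot2 c s (f : R * R -> \bar R) :
  (c ^+ 2 + s ^+ 2 = 1)%R ->
  measurable_fun setT f -> (forall z, 0 <= f z) ->
  \int[(N \x N)]_z f (rot2 c s z) = \int[(N \x N)]_z f z.
Proof.
have key c' s' (g : R * R -> \bar R) : (c' != -1)%R -> (c' ^+ 2 + s' ^+ 2 = 1)%R ->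
    measurable_fun setT g -> (forall z, 0 <= g z) ->
    \int[(N \x N)]_z g (rot2 c' s' z) = \int[(N \x N)]_z g z.
  move=> c1 cs mg g0.
  rewrite !ge0_integral_gauss2//; last exact: (measurableT_comp mg (measurable_rot2 _ _)).
  pose h := (fun z => g z * (gauss2_pdf z)%:E) : R * R -> \bar R.
  have mh : measurable_fun setT h.
    by apply: emeasurable_funM => //; apply/measurable_EFinP; exact: measurable_gauss2_pdf.
  have h0 z : 0 <= h z by rewrite mule_ge0// lee_fin gauss2_pdf_ge0.
  rewrite -[RHS](ge0_integral_rot2_lebesgue c1 cs mh h0).
  apply: eq_integral => z _; congr (_ * (expR (- _) / _)%:E).
  transitivity ((c' ^+ 2 + s' ^+ 2) * (z.1 ^+ 2 + z.2 ^+ 2))%R; first by rewrite cs mul1r.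
  by rewrite /rot2/=; ring.
move=> cs mf f0; have [c1|] := eqVneq c (-1)%R; last by move=> c1; exact: key.
have s0 : s = 0%R.
  by apply/eqP; rewrite -sqrf_eq0; apply/eqP; move: cs; rewrite c1 sqrrN expr1n -[RHS]addr0 => /addrI.
(* The half turn, excluded in [key], is the square of a quarter turn. *)
have e z : rot2 c s z = rot2 0 1 (rot2 0 1 z).
  by rewrite /rot2/= c1 s0; congr pair; ring.
have N10 : (0 != -1 :> R)%R by rewrite eq_sym oppr_eq0 oner_eq0.
have o1 : (0 ^+ 2 + 1 ^+ 2 = 1 :> R)%R by rewrite expr0n expr1n add0r.
under eq_integral do rewrite e.
rewrite (key 0%R 1%R (fun z => f (rot2 0 1 z)))//; first exact: key.
exact: (measurableT_comp mf (measurable_rot2 _ _)).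
Qed.

End gauss2.

(** * From the area of discs to the exponential law *)

Section exponential_law.
Local Open Scope ereal_scope.
Context {R : realType}.
Local Notation mu := (@lebesgue_measure R).
Local Notation N := (@normal_prob R 0 (Num.sqrt 2^-1)).

Lemma measure_itvNyo_unique (m1 m2 : {measure set (measurableTypeR R) -> \bar R}) :
  (forall s, m1 `]-oo, s[%classic = m2 `]-oo, s[%classic) ->
  (forall s, m1 `]-oo, s[%classic < +oo) ->
  forall A, measurable A -> m1 A = m2 A.
Proof.
move=> m12 m1y A mA.
refine (@measure_unique _ R (measurableTypeR R) (@RGenInftyO.G R) (fun n => `]-oo, (n%:R)%R[%classic) _ _ _ _ m1 m2 _ _ A mA) => //.
- exact: RGenInftyO.measurableE.
- move=> _ _ [x ->] [y ->]; exists (Num.min x y).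
  by apply/seteqP; split => z /=; rewrite !in_itv/= lt_min => /andP.
- by move=> n; exists (n%:R)%R.
- apply/seteqP; split => // x _; exists (Num.truncn `|x|).+1 => //=.
  by rewrite in_itv/=; apply: le_lt_trans (ler_norm x) (truncnS_gt _).
- by move=> _ [x ->].
Qed.

Lemma ge0_integral_scale2 (c : R) (f : R * R -> \bar R) : (0 < c)%R ->
  measurable_fun setT f -> (forall z, 0 <= f z) ->
  \int[(mu \x mu)]_z f (c * z.1, c * z.2)%R = (c ^- 2)%:E * \int[(mu \x mu)]_z f z.
Proof.
move=> c0 mf f0.
have mg : measurable_fun setT (fun z : R * R => f (c * z.1, c * z.2)%R).
  apply: measurableT_comp => //; apply/measurable_fun_pairP; split.
    by apply: measurable_funM => //.
  by apply: measurable_funM => //; exact: measurable_snd.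
apply: (eq_trans (@fubini_tonelli1 _ _ (measurableTypeR R) (measurableTypeR R) R mu mu _ mg (fun z => f0 _))).
have mF := @measurable_fun_fubini_tonelli_F _ _ (measurableTypeR R) (measurableTypeR R) R mu _ mf f0.
have F0 x : 0 <= fubini_F mu f x by apply: integral_ge0.
transitivity (\int[mu]_x (c^-1%:E * fubini_F mu f (c * x)%R)).
  apply: eq_integral => x _; rewrite /fubini_F/=.
  rewrite (ge0_integral_scale (f := fun y => f (c * x, y)%R))//.
  exact: measurableT_comp.
rewrite ge0_integralZl//; last 2 first.
- exact: (measurableT_comp mF).
- by rewrite lee_fin invr_ge0 ltW.
rewrite (ge0_integral_scale c0 mF F0) muleA -EFinM -invfM -expr2; congr (_ * _).
by rewrite (@fubini_tonelli1 _ _ (measurableTypeR R) (measurableTypeR R) R mu mu).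
Qed.

Lemma integral_expRN (a : R) :
  \int[mu]_(x in `[a, +oo[) (expR (- x))%:E = (expR (- a))%:E.
Proof.
rewrite (@ge0_continuous_FTC2y _ _ (fun x => - expR (- x))%R _ 0%R)//.
- by rewrite EFinN oppeK add0e.
- apply: continuous_subspaceT => x.
  by apply: continuous_comp; [exact: opp_continuous|exact: continuous_expR].
- by rewrite -oppr0; apply: cvgN; exact: cvgr_expR.
- apply: cvgN; apply/cvg_at_right_filter.
  by apply: continuous_comp; [exact: opp_continuous|exact: continuous_expR].
- move=> x _; rewrite derive1E.
  have d : is_derive x 1%R (fun x : R => - expR (- x))%R (expR (- x)).
    apply: is_derive_eq; rewrite /GRing.scale/=; ring.
  exact: derive_val.
Qed.

Lemma measurable_expRN : measurable_fun [set: R] (fun x : R => expR (- x)).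
Proof. exact: measurableT_comp. Qed.

Definition sqn2 (z : R * R) : R := (z.1 ^+ 2 + z.2 ^+ 2)%R.

Lemma measurable_sqn2 : measurable_fun setT sqn2.
Proof.
by apply: measurable_funD; apply: measurable_funX; [exact: measurable_fst|exact: measurable_snd].
Qed.

Let msqn2 : @measurable_fun _ _ (measurableTypeR R * measurableTypeR R)%type
  (measurableTypeR R) setT sqn2 := measurable_sqn2.

Let V := (mu \x mu) (sqn2 @^-1` `]-oo, 1%R[).

Let mball (s : R) : measurable (sqn2 @^-1` `]-oo, s[%classic).
Proof. by rewrite -[X in measurable X]setTI; exact: msqn2. Qed.

(* The area of a disc scales with the square of its radius; its value [pi] at
   radius 1 is not needed, being forced by normalization below. *)
Let disc_area (s : R) : (0 < s)%R ->
  (mu \x mu) (sqn2 @^-1` `]-oo, s[%classic) = s%:E * V.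
Proof.
move=> s0; have c0 : (0 < Num.sqrt s)%R by rewrite sqrtr_gt0.
have h : V = (s^-1)%:E * (mu \x mu) (sqn2 @^-1` `]-oo, s[%classic).
  have mI B : measurable B -> (mu \x mu) B = \int[(mu \x mu)]_z (\1_B z)%:E.
    exact: measure_integral_indic.
  rewrite /V (mI _ (mball 1%R)) (mI _ (mball s)).
  have mB : measurable_fun setT (fun z : R * R => (\1_(sqn2 @^-1` `]-oo, s[%classic) z)%:E : \bar R).
    by apply/measurable_EFinP; exact: measurable_indic.
  have B0 z : 0 <= (\1_(sqn2 @^-1` `]-oo, s[%classic) z)%:E :> \bar R.
    by rewrite lee_fin.
  have := ge0_integral_scale2 c0 mB B0.
  rewrite sqr_sqrtr ?(ltW s0)// => <-.
  apply: eq_integral => z _; rewrite !indicE; congr (_%:R%:E); congr (nat_of_bool _).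
  apply/idP/idP; rewrite !inE/= !in_itv/= /sqn2/= !exprMn sqr_sqrtr ?(ltW s0)//.
    by rewrite -mulrDr gtr_pMr.
  by rewrite -mulrDr gtr_pMr.
by rewrite h muleA -EFinM divff ?gt_eqF// mul1e.
Qed.

Let V_fin : V < +oo.
Proof.
apply: (@le_lt_trans _ _ ((mu \x mu) (`[(-1)%R, 1%R] `*` `[(-1)%R, 1%R]))).
  apply: le_measure; rewrite ?inE; [exact: mball|exact: measurableX|].
  move=> [x y] /=; rewrite !in_itv/= /sqn2/= => h.
  have x2 := sqr_ge0 x; have y2 := sqr_ge0 y.
  by split; apply/andP; split; nra.
rewrite product_measure1E//= lebesgue_measure_itv/= lte_fin ifT; last by lra.
by rewrite -EFinB -EFinM ltry.
Qed.

Let ballE (s : R) : (s <= 0)%R -> sqn2 @^-1` `]-oo, s[%classic = set0.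
Proof.
move=> s0; apply/seteqP; split => // z /=; rewrite in_itv/= => h.
have := lt_le_trans h s0; rewrite ltNge; move/negP; apply.
by rewrite addr_ge0 ?sqr_ge0.
Qed.

(** Polar coordinates without a change of variables: by [disc_area], the image of planar Lebesgue
    measure under [sqn2] and [V] times Lebesgue measure on the positive half-line agree on every
    []-oo, s[]. *)
Let sqn2_law (f : R -> \bar R) : measurable_fun setT f -> (forall s, 0 <= f s) ->
  \int[(mu \x mu)]_z f (sqn2 z) = V * \int[mu]_(s in `]0%R, +oo[) f s.
Proof.
move=> mf f0.
have V0 : (0 <= fine V)%R by rewrite fine_ge0// measure_ge0.
have VE : V = (fine V)%:E by rewrite fineK// ge0_fin_numE ?measure_ge0//; exact: V_fin.
pose k : {nonneg R} := NngNum V0.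
pose m2 := mscale k (mrestr mu (measurable_itv `]0%R, +oo[)).
rewrite -(ge0_integral_image_measure (mu \x mu) msqn2)//.
transitivity (\int[m2]_s f s).
  apply: eq_measure_integral => A mA _.
  refine (@measure_itvNyo_unique (image_measure (mu \x mu) msqn2) m2 _ _ A mA) => s.
    transitivity ((mu \x mu) (sqn2 @^-1` `]-oo, s[%classic)); first by [].
    rewrite /m2/= /mscale/= /mrestr -VE.
    have [s0|s0] := leP s 0%R.
      rewrite ballE// measure0 (_ : _ `&` _ = set0) ?measure0 ?mule0//.
      apply/seteqP; split => // x /=; rewrite !in_itv/= andbT => -[h1 h2].
      by have := lt_trans h2 (lt_le_trans h1 s0); rewrite ltxx.
    rewrite disc_area// muleC; congr (_ * _).
    rewrite (_ : _ `&` _ = `]0%R, s[%classic).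
      by rewrite lebesgue_measure_itv/= lte_fin s0 sube0.
    apply/seteqP; split => x /=; rewrite !in_itv/= andbT; first by move=> [-> ->].
    by move=> /andP[].
  change ((mu \x mu) (sqn2 @^-1` `]-oo, s[%classic) < +oo).
  have [s0|s0] := leP s 0%R; first by rewrite ballE// measure0 ltry.
  by rewrite disc_area// VE -EFinM ltry.
rewrite ge0_integral_mscale//= VE; congr (_ * _).
rewrite [RHS]integral_mkcond.
transitivity (\int[mu]_x (f x * (\1_(`]0%R, +oo[ : set R) x)%:E)).
  apply: ge0_integral_density => //.
  by move=> A mA /=; rewrite /mrestr integral_indic//= setIC.
by apply: eq_integral => x _; rewrite patchE indicE; case: ifPn => _; rewrite ?mule1 ?mule0.
Qed.

(** The planar density is a function of s = [sqn2 z] alone, namely exp (- s) / pi, so [sqn2_law]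
    makes the squared modulus of a CN(0,1) variable exponential. *)
Lemma ge0_integral_gauss2_sqn2 (f : R -> \bar R) :
  measurable_fun setT f -> (forall s, 0 <= f s) ->
  \int[(N \x N)]_z f (sqn2 z) = \int[mu]_(s in `]0%R, +oo[) (f s * (expR (- s))%:E).
Proof.
have key g : measurable_fun setT g -> (forall s, 0 <= g s) ->
  \int[(N \x N)]_z g (sqn2 z) =
    V * \int[mu]_(s in `]0%R, +oo[) (g s * (expR (- s) / pi)%:E).
  move=> mg g0.
  have mE : measurable_fun setT (fun s : R => (expR (- s) / pi)%:E).
    by apply/measurable_EFinP; apply: measurable_funM => //; exact: measurable_expRN.
  rewrite -(sqn2_law (f := fun s => g s * (expR (- s) / pi)%:E)); last 2 first.
  - exact: emeasurable_funM.
  - by move=> s; rewrite mule_ge0// lee_fin divr_ge0 ?expR_ge0 ?pi_ge0.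
  rewrite ge0_integral_gauss2//.
  apply: (measurableT_comp mg).
  exact: measurable_sqn2.
have mE : measurable_fun setT (fun s : R => (expR (- s))%:E).
  by apply/measurable_EFinP; exact: measurable_expRN.
have {}key g : measurable_fun setT g -> (forall s, 0 <= g s) ->
  \int[(N \x N)]_z g (sqn2 z) =
    V * (pi^-1)%:E * \int[mu]_(s in `]0%R, +oo[) (g s * (expR (- s))%:E).
  move=> mg g0; rewrite key// -muleA; congr (V * _); rewrite -ge0_integralZl//; last 3 first.
  - by apply: measurable_funTS; exact: emeasurable_funM.
  - by move=> s _; rewrite mule_ge0// lee_fin expR_ge0.
  - by rewrite lee_fin invr_ge0 pi_ge0.
  apply: eq_integral => s _.
  by rewrite [RHS]muleCA -EFinM [(pi^-1 * _)%R]mulrC.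
move=> mf f0; rewrite key//.
(* Testing with the constant 1 compares the total masses of two probability laws, which fixes the
   constant. *)
suff -> : V * (pi^-1)%:E = 1 by rewrite mul1e.
have := key (cst 1) (measurable_cst _) (fun _ => lee01).
rewrite integral_cst//= mul1e probability_setT => ->.
under eq_integral do rewrite mul1e.
rewrite integral_itv_obnd_cbnd; last exact: measurable_funTS.
by rewrite integral_expRN oppr0 expR0 mule1.
Qed.

End exponential_law.

Section gamma_density.
Context {R : realType}.
Local Notation mu := (@lebesgue_measure R).

(** Tonelli on the triangle 0 < x < y. It later stands in for integration by parts: when [b] is exp
    (- y), the inner integral on the left is exp (- x). *)
Lemma ge0_tonelli_triangle (a b : R -> \bar R) :
  measurable_fun setT a -> (forall x, 0 <= a x)%E ->
  measurable_fun setT b -> (forall x, 0 <= b x)%E ->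
  (\int[mu]_(x in `]0%R, +oo[) (a x * \int[mu]_(y in `]x, +oo[) b y) =
   \int[mu]_(y in `]0%R, +oo[) (b y * \int[mu]_(x in `]0%R, y[) a x))%E.
Proof.
move=> ma a0 mb b0.
pose K (z : R * R) : \bar R := (a z.1 * b z.2 * ((0 < z.1) && (z.1 < z.2))%:R%:E)%E.
have mK : measurable_fun setT K.
  apply: emeasurable_funM.
    apply: emeasurable_funM.
      exact: (measurableT_comp ma measurable_fst).
    exact: (measurableT_comp mb measurable_snd).
  apply/measurable_EFinP.
  rewrite (_ : (fun z : R * R => _) =
    \1_([set z : R * R | (fun z => (0 < z.1) && (z.1 < z.2)) z])); last first.
    by apply/funext => z; rewrite indicE; congr (nat_of_bool _)%:R; apply/idP/idP; rewrite inE.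
  apply: measurable_indic.
  have h : measurable_fun setT (fun z : R * R => (0 < z.1) && (z.1 < z.2)).
    apply: measurable_and; apply: measurable_fun_ltr => //; exact: measurable_snd.
  by rewrite -[X in measurable X]setTI; exact: (h measurableT [set true]).
have K0 z : (0 <= K z)%E by rewrite /K !mule_ge0// lee_fin.
have := @fubini_tonelli _ _ (measurableTypeR R) (measurableTypeR R) R mu mu _ mK K0.
rewrite [X in X = _ -> _](_ : _ =
    \int[mu]_(x in `]0%R, +oo[) (a x * \int[mu]_(y in `]x, +oo[) b y))%E; last first.
  rewrite [RHS]integral_mkcond; apply: eq_integral => x _.
  rewrite patchE; case: ifPn => [|]; last first.
    rewrite notin_setE/= in_itv/= andbT => /negP/negbTE x0.
    by apply: integral0_eq => y _; rewrite /K/= x0 mule0.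
  rewrite inE/= in_itv/= andbT => x0.
  rewrite -ge0_integralZl//; last exact: measurable_funTS.
  rewrite [RHS]integral_mkcond; apply: eq_integral => y _.
  rewrite patchE /K/= x0/=; case: ifPn.
    by rewrite inE/= in_itv/= andbT => ->; rewrite mule1.
  by rewrite notin_setE/= in_itv/= andbT => /negP/negbTE ->; rewrite mule0.
move=> ->.
rewrite [RHS]integral_mkcond; apply: eq_integral => y _.
rewrite patchE; case: ifPn => [|]; last first.
  rewrite notin_setE/= in_itv/= andbT => /negP y0.
  apply: integral0_eq => x _; rewrite /K/=.
  have [/andP[x0 xy]|_] := boolP ((0 < x) && (x < y)); last by rewrite mule0.
  by rewrite (lt_trans x0 xy) in y0.
rewrite inE/= in_itv/= andbT => y0.
rewrite -ge0_integralZl//; last exact: measurable_funTS.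
rewrite [RHS]integral_mkcond; apply: eq_integral => x _.
rewrite patchE /K/= [(b y * _)%E]muleC; case: ifPn.
  by rewrite inE/= in_itv/= => ->; rewrite mule1.
by rewrite notin_setE/= in_itv/= => /negP/negbTE ->; rewrite mule0.
Qed.

Lemma is_derive_exprn n (x : R) :
  is_derive x (1 : R) (fun x : R => x ^+ n) (n%:R * x ^+ n.-1).
Proof.
apply: DeriveDef; first exact: exprn_derivable.
by rewrite exp_derive /GRing.scale/= mulr1.
Qed.

Lemma integral_exprn_fact n (y : R) : 0 < y ->
  (\int[mu]_(x in `]0%R, y[) (x ^+ n / n`!%:R)%:E = (y ^+ n.+1 / n.+1`!%:R)%:E)%E.
Proof.
move=> y0.
have mf : measurable_fun setT (fun x : R => (x ^+ n / n`!%:R)%:E).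
  by apply/measurable_EFinP; apply: measurable_funM => //; exact: measurable_funX.
rewrite -(@integral_itv_bndoo _ 0 y _ true false); last exact: measurable_funTS.
have d (x : R) : is_derive x (1 : R) (fun x : R => x ^+ n.+1 / n.+1`!%:R) (x ^+ n / n`!%:R).
  have -> : (fun x : R => x ^+ n.+1 / n.+1`!%:R) = n.+1`!%:R^-1 \*: (fun x : R => x ^+ n.+1).
    by apply/funext => z; rewrite mulrC.
  have dX := is_derive_exprn n.+1 x.
  apply: is_derive_eq; rewrite /GRing.scale/= factS natrM; field.
  by rewrite nat1r !pnatr_eq0/= -lt0n fact_gt0.
rewrite (@continuous_FTC2 _ _ (fun x => x ^+ n.+1 / n.+1`!%:R)).
- by rewrite expr0n/= mul0r sube0.
- exact: y0.
- apply: continuous_subspaceT => x; apply: cvgM; last exact: cvg_cst.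
  exact: exprn_continuous.
- split.
  + by move=> x _; exact: (@ex_derive _ _ _ _ _ _ _ (d x)).
  + apply/cvg_at_right_filter; apply: cvgM; last exact: cvg_cst.
    exact: exprn_continuous.
  + apply/cvg_at_left_filter; apply: cvgM; last exact: cvg_cst.
    exact: exprn_continuous.
- by move=> x _; rewrite derive1E; exact: (@derive_val _ _ _ _ _ _ _ (d x)).
Qed.

(** On x > 0, the Gamma density of shape [n.+1]; thus [n = 0] is the exponential law. *)
Definition gamma_pdf n (x : R) : R := x ^+ n * expR (- x) / n`!%:R.

Lemma gamma_pdf_ge0 n x : 0 <= x -> 0 <= gamma_pdf n x.
Proof. by move=> x0; rewrite divr_ge0 ?mulr_ge0 ?exprn_ge0 ?expR_ge0. Qed.

Lemma measurable_gamma_pdf n : measurable_fun setT (gamma_pdf n).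
Proof.
apply: measurable_funM => //; apply: measurable_funM; first exact: measurable_funX.
exact: measurable_expRN.
Qed.

(** Adding an independent exponential variable raises the shape by one: after the substitution x = u
    + s the exponentials combine into exp (- x), and only s^n / n! remains to be integrated over s <
    x. *)
Lemma ge0_integral_convolution_expRN n (f : R -> \bar R) :
  measurable_fun setT f -> (forall x, 0 <= f x)%E ->
  (\int[mu]_(s in `]0%R, +oo[)
     ((\int[mu]_(u in `]0%R, +oo[) (f (u + s)%R * (expR (- u))%:E)) * (gamma_pdf n s)%:E) =
   \int[mu]_(x in `]0%R, +oo[) (f x * (gamma_pdf n.+1 x)%:E))%E.
Proof.
move=> mf f0.
(* The absolute value makes [a] nonnegative on the whole line, as the triangle lemma demands; only s
   > 0 contributes. *)
pose a (s : R) : \bar R := (`|s| ^+ n / n`!%:R)%:E.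
pose b (x : R) : \bar R := (f x * (expR (- x))%:E)%E.
have ma : measurable_fun setT a.
  apply/measurable_EFinP; apply: measurable_funM => //; apply: measurable_funX.
  exact: normr_measurable.
have a0 s : (0 <= a s)%E by rewrite lee_fin divr_ge0// exprn_ge0.
have mb : measurable_fun setT b.
  by apply: emeasurable_funM => //; apply/measurable_EFinP; exact: measurable_expRN.
have b0 x : (0 <= b x)%E by rewrite mule_ge0// lee_fin expR_ge0.
transitivity (\int[mu]_(s in `]0%R, +oo[) (a s * \int[mu]_(x in `]s, +oo[) b x))%E.
  apply: eq_integral => s; rewrite inE/= in_itv/= andbT => s0.
  have -> : (\int[mu]_(x in `]s, +oo[) b x =
      \int[mu]_(u in `]0%R, +oo[) (f (u + s)%R * (expR (- (u + s)))%:E))%E.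
    rewrite integral_mkcond [RHS]integral_mkcond.
    rewrite -(ge0_integral_translate s); last 2 first.
    - by apply/(measurable_restrictT _ _).1 => //; exact: measurable_funTS.
    - by move=> x; rewrite patchE; case: ifP.
    apply: eq_integral => u _; rewrite !patchE.
    have -> : (u + s \in `]s, +oo[%classic) = (u \in `]0%R, +oo[%classic).
      by apply/idP/idP; rewrite !inE/= !in_itv/= !andbT ltrDr.
    by case: ifP.
  have mu' : measurable_fun setT (fun u : R => f (u + s)%R).
    by apply: measurableT_comp => //; exact: measurable_funD.
  rewrite muleC -[LHS]ge0_integralZl//; last 3 first.
  - by apply: measurable_funTS; apply: emeasurable_funM => //; apply/measurable_EFinP;
      exact: measurable_expRN.
  - by move=> u _; rewrite mule_ge0// lee_fin expR_ge0.
  - by rewrite lee_fin gamma_pdf_ge0// ltW.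
  rewrite -[RHS]ge0_integralZl; [|exact: measurable_itv| | |exact: a0]; last 2 first.
  - by apply: measurable_funTS; apply: emeasurable_funM => //; apply/measurable_EFinP;
      apply: (measurableT_comp measurable_expRN); exact: measurable_funD.
  - by move=> u _; rewrite mule_ge0// lee_fin expR_ge0.
  apply: eq_integral => u _; rewrite muleCA [RHS]muleCA; congr (_ * _)%E.
  rewrite /a -!EFinM ger0_norm ?ltW//; congr (_%:E).
  by rewrite opprD expRD /gamma_pdf; ring.
rewrite ge0_tonelli_triangle//; apply: eq_integral => y; rewrite inE/= in_itv/= andbT => y0.
rewrite (_ : \int[mu]_(x in `]0%R, y[) a x = (y ^+ n.+1 / n.+1`!%:R)%:E)%E; last first.
  rewrite -integral_exprn_fact//; apply: eq_integral => x; rewrite inE/= in_itv/= => /andP[x0 _].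
  by rewrite /a ger0_norm// ltW.
by rewrite /b -muleA -EFinM /gamma_pdf; congr (_ * _%:E)%E; ring.
Qed.

End gamma_density.

(** * Gaussian families *)

Section random_vectors.
Context {R : realType} {I : finType}.
Local Open Scope ereal_scope.
Local Notation N := (@normal_prob R 0 (Num.sqrt 2^-1)).

Definition rectangles : set (set (I -> R)) :=
  [set A | exists2 B : I -> set R, (forall i, measurable (B i)) &
           A = [set f | forall i, B i (f i)]].

(** The functions on a finite index type with their product sigma-algebra, on which joint laws live
    as measures. *)
Definition vectors := g_sigma_algebraType rectangles.

Lemma measurable_rectangle (B : I -> set R) : (forall i, measurable (B i)) ->
  measurable ([set f | forall i, B i (f i)] : set vectors).
Proof. by move=> mB; apply: sub_sigma_algebra; exists B. Qed.

Lemma measurable_coordinate i : measurable_fun [set: vectors] (fun f : vectors => f i).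
Proof.
move=> _ A mA; rewrite setTI.
rewrite (_ : _ @^-1` A = [set f | forall j, (if j == i then A else setT) (f j)]).
  apply: (@measurable_rectangle (fun j => if j == i then A else setT)) => j.
  by case: ifP.
apply/seteqP; split => [f /= Af j|f /= /(_ i)]; last by rewrite eqxx.
by case: ifPn => [/eqP ->|].
Qed.

Lemma measurable_vectorP d (T : measurableType d) (g : T -> vectors) :
  (forall i, measurable_fun setT (fun w => g w i)) -> measurable_fun setT g.
Proof.
move=> mg; apply: (@measurability _ _ T vectors _ _ rectangles erefl) => _ [_ [B mB ->] <-].
rewrite setTI (_ : _ @^-1` _ = \bigcap_(i in [set: I]) (fun w => g w i) @^-1` B i); last first.
  by apply/seteqP; split => w /= h i; [move=> _|]; exact: h.
apply: fin_bigcap_measurable => // i _.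
by rewrite -[X in measurable X]setTI; exact: mg.
Qed.

(** The coordinates selected by [p] are i.i.d. of variance 1/2. The predicate lets one family be cut
    into independent blocks, such as the first column of a matrix and the rest. *)
Definition gaussian_on d (T : measurableType d) (P : probability T R)
    (p : pred I) (X : I -> T -> R) : Prop :=
  (forall i, p i -> measurable_fun setT (X i)) /\
  forall B : I -> set R, (forall i, measurable (B i)) ->
    P [set w | forall i, p i -> B i (X i w)] = \prod_(i | p i) N (B i).

Lemma gaussian_onS d (T : measurableType d) (P : probability T R) (p q : pred I) X :
  {subset q <= p} -> gaussian_on P p X -> gaussian_on P q X.
Proof.
move=> qp [mX PX]; split=> [i qi|B mB]; first exact/mX/qp.
pose B' i := if q i then B i else setT.
have -> : [set w | forall i, q i -> B i (X i w)] = [set w | forall i, p i -> B' i (X i w)].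
  apply/seteqP; split => w /= h i.
    by move=> pi; rewrite /B'; case: ifPn => // qi; exact: h.
  by move=> qi; have := h i (qp _ qi); rewrite /B' qi.
rewrite PX; last by move=> i; rewrite /B'; case: ifP.
rewrite (bigID q)/= [X in _ * X]big1 ?mule1; last first.
  by move=> i /andP[_ /negbTE qi]; rewrite /B' qi probability_setT.
apply: eq_big => [i|i /andP[_ qi]]; last by rewrite /B' qi.
by apply/andP/idP => [[]//|qi]; split => //; exact: qp.
Qed.

Lemma eq_gaussian_on d (T : measurableType d) (P : probability T R) (p : pred I) X Y :
  (forall i, p i -> X i =1 Y i) -> gaussian_on P p X -> gaussian_on P p Y.
Proof.
move=> XY [mX PX]; split=> [i pi|B mB].
  have <- : X i = Y i by apply/funext => w; exact: XY.
  exact: mX.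
rewrite -PX//; congr (P _); apply/seteqP; split => w /= h i pi; have := h i pi; by rewrite XY.
Qed.

Lemma measurable_preimage_rectangle d (T : measurableType d) (q : pred I)
    (Z : I -> T -> R) (B : I -> set R) :
  (forall i, measurable (B i)) -> (forall i, q i -> measurable_fun setT (Z i)) ->
  measurable [set w | forall i, q i -> B i (Z i w)].
Proof.
move=> mB mZ; rewrite (_ : [set _ | _] = \bigcap_(i in [set i | q i]) (Z i @^-1` B i))//.
apply: fin_bigcap_measurable => // i qi.
by rewrite -[X in measurable X]setTI; exact: mZ.
Qed.

(** Two blocks drawn from separate probability spaces form one Gaussian family on the product.
    Replacing a family by such a copy makes conditioning on a block an application of Tonelli. *)
Lemma gaussian_on_prod d1 d2 (T1 : measurableType d1) (T2 : measurableType d2)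
    (P1 : probability T1 R) (P2 : probability T2 R) (p : pred I) X Y :
  gaussian_on P1 p X -> gaussian_on P2 (predC p) Y ->
  gaussian_on (P1 \x P2) predT (fun i w => if p i then X i w.1 else Y i w.2).
Proof.
move=> [mX PX] [mY PY]; split=> [i _|B mB].
  case: (boolP (p i)) => pi.
    exact: (measurableT_comp (mX _ pi) measurable_fst).
  exact: (measurableT_comp (mY i pi) measurable_snd).
rewrite (_ : [set _ | _] = [set w | forall i, p i -> B i (X i w)] `*`
                           [set w | forall i, predC p i -> B i (Y i w)]); last first.
  apply/seteqP; split => [[w1 w2] /= h|[w1 w2] /= [h1 h2] i _].
    by split => i pi; have := h i isT; rewrite ?pi// (negbTE pi).
  by case: ifPn => pi; [exact: h1|exact: h2].
rewrite [LHS]product_measure1E;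
  [|exact: measurable_preimage_rectangle|exact: measurable_preimage_rectangle].
by rewrite [RHS](bigID p)/=; congr (_ * _); [exact: PX|exact: PY].
Qed.

(** Rectangles are stable under intersection and generate the sigma-algebra, so the probabilities in
    [gaussian_on] determine the joint law, whatever the underlying space. *)
Lemma gaussian_law_set d1 d2 (T1 : measurableType d1) (T2 : measurableType d2)
    (P1 : probability T1 R) (P2 : probability T2 R) X Y (A : set vectors) :
  gaussian_on P1 predT X -> gaussian_on P2 predT Y -> measurable A ->
  P1 [set w | A (fun i => X i w)] = P2 [set w | A (fun i => Y i w)].
Proof.
move=> [mX PX] [mY PY] mA.
have mX' : @measurable_fun _ _ T1 vectors setT (fun w i => X i w).
  by apply: measurable_vectorP => i; exact: mX.
have mY' : @measurable_fun _ _ T2 vectors setT (fun w i => Y i w).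
  by apply: measurable_vectorP => i; exact: mY.
refine (@measure_unique _ R vectors rectangles (fun=> setT) _ _ _ _
  (image_measure P1 mX') (image_measure P2 mY') _ _ A mA) => //.
- move=> _ _ [B mB ->] [C mC ->]; exists (fun i => B i `&` C i).
    by move=> i; exact: measurableI.
  apply/seteqP; split => f /=; first by move=> [h1 h2] i; split.
  by move=> h; split => i; have [] := h i.
- by move=> _; exists (fun=> setT) => //; apply/seteqP; split.
- by rewrite bigcup_const//; exists 0%N.
- move=> _ [B mB ->].
  transitivity (P1 [set w | forall i, predT i -> B i (X i w)]).
    by congr (P1 _); apply/seteqP; split => w /= h i; [move=> _|]; exact: h.
  rewrite PX// -PY//.
  by congr (P2 _); apply/seteqP; split => w /= h i; [|move=> _]; exact: h.
- move=> _; rewrite [X in X < _](_ : _ = P1 setT); last by congr (P1 _).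
  by rewrite probability_setT ltry.
Qed.

Lemma gaussian_law d1 d2 (T1 : measurableType d1) (T2 : measurableType d2)
    (P1 : probability T1 R) (P2 : probability T2 R) X Y (F : vectors -> \bar R) :
  gaussian_on P1 predT X -> gaussian_on P2 predT Y ->
  measurable_fun setT F -> (forall f, 0 <= F f) ->
  \int[P1]_w F (fun i => X i w) = \int[P2]_w F (fun i => Y i w).
Proof.
move=> gX gY mF F0.
have mX' : @measurable_fun _ _ T1 vectors setT (fun w i => X i w).
  by apply: measurable_vectorP => i; exact: gX.1.
have mY' : @measurable_fun _ _ T2 vectors setT (fun w i => Y i w).
  by apply: measurable_vectorP => i; exact: gY.1.
rewrite -(ge0_integral_image_measure P1 mX')// -(ge0_integral_image_measure P2 mY')//.
by apply: eq_measure_integral => A mA _; exact: gaussian_law_set.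
Qed.

End random_vectors.

Lemma gaussian_on_inj (R : realType) (I J : finType) d (T : measurableType d)
    (P : probability T R) (p : pred I) (X : I -> T -> R) (s : J -> I) :
  injective s -> (forall j, p (s j)) -> gaussian_on P p X ->
  gaussian_on P predT (fun j => X (s j)).
Proof.
move=> inj_s ps gX; split=> [j _|B mB]; first exact/gX.1/ps.
have sub : {subset codom s <= p} by move=> _ /codomP[j ->]; exact: ps.
have [_ PX] := gaussian_onS sub gX.
(* [B] transported along [s] by a partial inverse. *)
pose B' i := if [pick j | s j == i] is Some j then B j else setT.
have B's j : B' (s j) = B j.
  rewrite /B'; case: pickP => [k /eqP/inj_s -> //|/(_ j)]; by rewrite eqxx.
have -> : [set w | forall j, predT j -> B j (X (s j) w)] =
          [set w | forall i, i \in codom s -> B' i (X i w)].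
  apply/seteqP; split => w /= h.
    by move=> _ /codomP[j ->]; rewrite B's; exact: h.
  by move=> j _; rewrite -B's; apply: h; exact: codom_f.
rewrite PX; last by move=> i; rewrite /B'; case: pickP.
rewrite -big_uniq/=; last by rewrite map_inj_uniq ?enum_uniq.
by rewrite big_image/=; apply: eq_bigr => j _; rewrite B's.
Qed.

Section rotations.
Context {R : realType} {I : finType} d (T : measurableType d) (P : probability T R).
Local Open Scope ereal_scope.
Local Notation N := (@normal_prob R 0 (Num.sqrt 2^-1)).

Lemma gaussian_on_pair (k l : I) : k != l ->
  gaussian_on (N \x N) (pred2 k l) (fun i (z : R * R) => if i == k then z.1 else z.2).
Proof.
move=> kl; split=> [i _|B mB].
  by case: (i == k); [exact: measurable_fst|exact: measurable_snd].
rewrite (_ : [set _ | _] = B k `*` B l); last first.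
  apply/seteqP; split => [[x y] /= h|[x y] /= [h1 h2] i /orP[]/eqP ->].
  - by split; [have := h k|have := h l]; rewrite !eqxx ?orbT ?[l == k]eq_sym ?(negbTE kl); exact.
  - by rewrite eqxx.
  - by rewrite eq_sym (negbTE kl).
rewrite [LHS]product_measure1E; [|exact: mB|exact: mB].
rewrite (bigD1 k)/= ?eqxx//; congr (_ * _).
have e i : ((i == k) || (i == l)) && (i != k) = (i == l).
  by have [->|] := eqVneq i k; rewrite /= ?andbF ?andbT// (negbTE kl).
by rewrite (eq_bigl _ _ e) big_pred1_eq.
Qed.

(** The family is first replaced by a copy on [(N \x N) \x P] whose coordinates [k] and [l] come
    from the planar factor; the rotation then acts on that factor only. *)
Lemma gaussian_rotate (X Y : I -> T -> R) (k l : I) (c s : R) :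
  k != l -> (c ^+ 2 + s ^+ 2 = 1)%R -> gaussian_on P predT X ->
  (forall w, Y k w = c * X k w + s * X l w)%R ->
  (forall w, Y l w = - s * X k w + c * X l w)%R ->
  (forall i, i != k -> i != l -> Y i =1 X i) ->
  gaussian_on P predT Y.
Proof.
move=> kl cs gX Yk Yl YX.
have lk : (l == k) = false by rewrite eq_sym; exact/negbTE.
pose rho (f : @vectors R I) : @vectors R I := fun i =>
  if i == k then (c * f k + s * f l)%R
  else if i == l then (- s * f k + c * f l)%R else f i.
have mrho : measurable_fun setT rho.
  apply: measurable_vectorP => i; rewrite /rho.
  by case: (i == k); [|case: (i == l)]; [| |exact: measurable_coordinate];
    apply: measurable_funD; apply: measurable_funM => //; exact: measurable_coordinate.
have YE w : (fun i => Y i w) = rho (fun i => X i w).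
  apply/funext => i; rewrite /rho; have [->//|ik] := eqVneq i k.
  by have [->//|il] := eqVneq i l; exact: YX.
split=> [i _|B mB].
  have -> : Y i = (fun f : @vectors R I => f i) \o rho \o (fun w i => X i w).
    by apply/funext => w /=; rewrite -YE.
  apply: measurableT_comp; last first.
    by apply: measurable_vectorP => j; exact: gX.1.
  by apply: measurableT_comp => //; exact: measurable_coordinate.
pose A := rho @^-1` [set f | forall i, B i (f i)].
have mA : measurable A.
  by rewrite -[X in measurable X]setTI; apply: mrho => //; exact: measurable_rectangle.
pose q := pred2 k l.
have gX' : gaussian_on P (predC q) X by apply: gaussian_onS gX.
have gZ := gaussian_on_prod (gaussian_on_pair kl) gX'.
transitivity (P [set w | A (fun i => X i w)]).
  by congr (P _); apply/seteqP; split => w h /=; rewrite /A/= -?YE => i;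
    [exact: h|move=> _; have := h i; rewrite -YE].
rewrite (gaussian_law_set gX gZ mA).
(* For the copy, the preimage of a rectangle is the product of a planar set [C] and a condition [D]
   on the remaining coordinates. *)
pose C := rot2 c s @^-1` (B k `*` B l).
have mC : measurable C.
  by rewrite -[X in measurable X]setTI; apply: measurable_rot2 => //; exact: measurableX.
pose D := [set w | forall i, predC q i -> B i (X i w)].
have mD : measurable D.
  by apply: measurable_preimage_rectangle => // i _; exact: gX.1.
rewrite (_ : [set _ | _] = C `*` D); last first.
  apply/seteqP; split => [[[x y] w] /= h|[[x y] w] /= [[h1 h2] h3] i].
  - have hk := h k; have hl := h l.
    move: hk hl; rewrite /rho/= !eqxx /= lk/= => hk hl; split; first by split.
    move=> i /= qi; have := h i; move: (qi); rewrite negb_or => /andP[/negbTE ik /negbTE il].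
    by rewrite /rho/= ik il/=.
  - rewrite /rho/= !eqxx /= lk/= ?orbT.
    have [->//|ik] := eqVneq i k; have [->//|il] := eqVneq i l.
    by apply: h3; rewrite /= negb_or ik.
rewrite [LHS]product_measure1E; [|exact: mC|exact: mD].
rewrite [RHS](bigID q)/=; congr (_ * _); last exact: gX'.2.
apply: (eq_trans _ ((gaussian_on_pair kl).2 B mB)).
have mBB : measurable (B k `*` B l) by exact: measurableX.
transitivity ((N \x N) (B k `*` B l)).
  have mI A' : measurable A' -> (N \x N) A' = \int[(N \x N)]_z (\1_A' z)%:E.
    exact: measure_integral_indic.
  rewrite (mI _ mC) (mI _ mBB).
  rewrite -[RHS](@ge0_integral_rot2 _ c s (fun z => (\1_(B k `*` B l) z)%:E))//.
  by apply/measurable_EFinP; exact: measurable_indic.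
congr ((N \x N) _); apply/seteqP; split => [[x y] /= [h1 h2] i /orP[]/eqP ->|[x y] /= h].
- by rewrite eqxx.
- by rewrite lk.
- by split; [have := h k|have := h l]; rewrite !eqxx ?orbT ?lk; exact.
Qed.

(** The pairs are disjoint, so they can be rotated one after the other along a list enumerating
    [J]. *)
Lemma gaussian_rotate_pairs (J : finType) (X Y : I -> T -> R) (k l : J -> I) (c s : R) :
  injective k -> injective l -> (forall i j, k i != l j) ->
  (c ^+ 2 + s ^+ 2 = 1)%R -> gaussian_on P predT X ->
  (forall j w, Y (k j) w = c * X (k j) w + s * X (l j) w)%R ->
  (forall j w, Y (l j) w = - s * X (k j) w + c * X (l j) w)%R ->
  (forall i, i \notin codom k -> i \notin codom l -> Y i =1 X i) ->
  gaussian_on P predT Y.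
Proof.
move=> ik il kl cs gX Yk Yl YX.
have key (r : seq J) : uniq r -> forall Y,
    (forall j w, j \in r -> Y (k j) w = c * X (k j) w + s * X (l j) w)%R ->
    (forall j w, j \in r -> Y (l j) w = - s * X (k j) w + c * X (l j) w)%R ->
    (forall i, i \notin map k r -> i \notin map l r -> Y i =1 X i) ->
    gaussian_on P predT Y.
  elim: r => [_ Y' _ _ Y'X|j r IH /= /andP[jr ur] Y' Y'k Y'l Y'X].
    by apply: eq_gaussian_on gX => i _ w; rewrite Y'X.
  have kr : k j \notin map k r by rewrite mem_map.
  have lr : l j \notin map l r by rewrite mem_map.
  have kr' : k j \notin map l r by apply/negP => /mapP[i _ /eqP]; exact/negP/kl.
  have lr' : l j \notin map k r by apply/negP => /mapP[i _ /esym/eqP]; exact/negP/kl.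
  (* The family in which the pairs of [r] are rotated and the pair of [j] is not yet. *)
  pose Y0 i := if (i == k j) || (i == l j) then X i else Y' i.
  have Y0k : Y0 (k j) = X (k j) by rewrite /Y0 eqxx.
  have Y0l : Y0 (l j) = X (l j) by rewrite /Y0 eqxx orbT.
  have gY0 : gaussian_on P predT Y0.
    apply: IH => // [i w ir|i w ir|i h1 h2 w].
    - rewrite /Y0 (negbTE (kl _ _)) orbF (inj_eq ik) ifF; last first.
        by apply: contraNF jr => /eqP <-.
      by apply: Y'k; rewrite inE ir orbT.
    - rewrite /Y0 [l i == k j]eq_sym (negbTE (kl _ _)) (inj_eq il) ifF; last first.
        by apply: contraNF jr => /eqP <-.
      by apply: Y'l; rewrite inE ir orbT.
    - rewrite /Y0; case: ifPn => // /norP[h3 h4].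
      by apply: Y'X; rewrite inE negb_or ?h3 ?h4.
  apply: (gaussian_rotate (kl j j) cs gY0).
  - by move=> w; rewrite Y0k Y0l; apply: Y'k; rewrite inE eqxx.
  - by move=> w; rewrite Y0k Y0l; apply: Y'l; rewrite inE eqxx.
  - by move=> i h1 h2 w; rewrite /Y0 (negbTE h1) (negbTE h2).
apply: (key (enum J) (enum_uniq _)).
- by move=> j w _; exact: Yk.
- by move=> j w _; exact: Yl.
- by move=> i h1 h2; exact: YX.
Qed.

End rotations.

(** * Squared norms of complex Gaussian vectors *)

Section chi2.
Context {R : realType}.
Local Open Scope ereal_scope.
Local Notation mu := (@lebesgue_measure R).
Local Notation N := (@normal_prob R 0 (Num.sqrt 2^-1)).

Lemma measurable_sum_sqn2 n :
  measurable_fun setT (fun f : @vectors R ('I_n * bool)%type =>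
    \sum_(i < n) (f (i, false) ^+ 2 + f (i, true) ^+ 2))%R.
Proof.
apply: measurable_sum => i.
by apply: measurable_funD; apply: measurable_funX; exact: measurable_coordinate.
Qed.

(* The planar law is kept abstract here: unification of product measures
   built on [normal_prob] does not terminate in reasonable time. *)
Let gaussian_sqnorm_aux (G : probability (measurableTypeR R * measurableTypeR R)%type R)
    (pairG : forall (I : finType) (k l : I), k != l ->
      gaussian_on G (pred2 k l) (fun i (z : R * R) => if i == k then z.1 else z.2))
    (sqn2G : forall f : R -> \bar R, measurable_fun setT f -> (forall s, 0 <= f s) ->
      \int[G]_z f (sqn2 z) = \int[mu]_(s in `]0%R, +oo[) (f s * (expR (- s))%:E))
    n d (T : measurableType d) (P : probability T R)
    (X : 'I_n.+1 * bool -> T -> R) (f : R -> \bar R) :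
  gaussian_on P predT X -> measurable_fun setT f -> (forall s, 0 <= f s) ->
  \int[P]_w f (\sum_(i < n.+1) (X (i, false) w ^+ 2 + X (i, true) w ^+ 2))%R =
  \int[mu]_(x in `]0%R, +oo[) (f x * (gamma_pdf n x)%:E).
Proof.
elim: n => [|n IH] in d T P X f *; move=> gX mf f0.
  have gY : gaussian_on G predT
      (fun (i : 'I_1 * bool) (z : R * R) => if i == (ord0, false) then z.1 else z.2).
    have := pairG ('I_1 * bool)%type (ord0, false) (ord0, true) isT.
    by apply: gaussian_onS => -[i []] _; rewrite ord1.
  have mF := measurableT_comp mf (@measurable_sum_sqn2 1%N).
  rewrite (gaussian_law gX gY mF (fun h => f0 _)).
  under eq_integral do rewrite /= big_ord1/=.
  rewrite (sqn2G _ mf f0).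
  apply: eq_integral => x _; rewrite /gamma_pdf; congr (_ * _%:E).
  by rewrite expr0 mul1r fact0 divr1.
have om : ((ord_max, false) : 'I_n.+2 * bool) != (ord_max, true) by rewrite xpair_eqE andbF.
(* The last complex coordinate moves to a planar factor of its own; its squared modulus is the
   exponential variable of the convolution. *)
pose q := pred2 ((ord_max, false) : 'I_n.+2 * bool) (ord_max, true).
have gX' : gaussian_on P (predC q) X by apply: gaussian_onS gX.
have gZ := gaussian_on_prod (pairG _ _ _ om) gX'.
pose X1 (j : 'I_n.+1 * bool) := X (widen_ord (leqnSn _) j.1, j.2).
have gX1 : gaussian_on P predT X1.
  apply: (gaussian_on_inj (s := fun j : 'I_n.+1 * bool => (widen_ord (leqnSn _) j.1, j.2)) _ _ gX) => //.
  by move=> [i b] [j c] [/ord_inj -> ->].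
pose S w : R := (\sum_(i < n.+1) (X1 (i, false) w ^+ 2 + X1 (i, true) w ^+ 2))%R.
have mS : measurable_fun setT S.
  apply: measurable_sum => i.
  by apply: measurable_funD; apply: measurable_funX; exact: gX1.1.
have mF := measurableT_comp mf (@measurable_sum_sqn2 n.+2).
rewrite (gaussian_law gX gZ mF (fun h => f0 _)).
transitivity (\int[(G \x P)]_z f (sqn2 z.1 + S z.2)%R).
  apply: eq_integral => -[z w] _.
  pose Z (i : 'I_n.+2 * bool) : R :=
    if q i then if i == (ord_max, false) then z.1 else z.2 else X i w.
  have Z1 : Z (ord_max, false) = z.1 by rewrite /Z /q /pred2 /= eqxx.
  have Z2 : Z (ord_max, true) = z.2.
    by rewrite /Z ifT; [rewrite eq_sym (negbTE om)|rewrite /q /pred2 /= eqxx orbT].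
  have ZX i b : Z (widen_ord (leqnSn n.+1) i, b) = X1 (i, b) w.
    have ni : widen_ord (leqnSn n.+1) i == ord_max = false.
      by apply/negbTE; rewrite -(inj_eq val_inj) neq_ltn (ltn_ord i).
    by rewrite /Z ifF// /q /pred2 /= !xpair_eqE ni.
  transitivity (f (\sum_(i < n.+2) (Z (i, false) ^+ 2 + Z (i, true) ^+ 2))%R); first by [].
  transitivity (f (sqn2 z + S w)%R); last by [].
  congr f; rewrite big_ord_recr Z1 Z2 /S /sqn2 [RHS]addrC; congr (_ + _)%R.
  by apply: eq_bigr => i _; rewrite !ZX.
have mfz : measurable_fun setT (fun z : (measurableTypeR R * measurableTypeR R) * T =>
    f (sqn2 z.1 + S z.2)%R).
  apply: measurableT_comp => //; apply: measurable_funD.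
    exact: (measurableT_comp measurable_sqn2 measurable_fst).
  exact: (measurableT_comp mS measurable_snd).
rewrite fubini_tonelli2//=.
pose g (s : R) := \int[mu]_(u in `]0%R, +oo[) (f (u + s)%R * (expR (- u))%:E).
transitivity (\int[P]_w g (S w)).
  apply: eq_integral => w _; rewrite /fubini_G/= /g.
  rewrite (sqn2G (fun u => f (u + S w)%R))//.
  by apply: measurableT_comp => //; exact: measurable_funD.
rewrite (IH _ _ _ X1 g)//; last 2 first.
- rewrite /g.
  under eq_fun do rewrite integral_mkcond.
  pose h (z : R * R) : \bar R := (f (z.1 + z.2)%R * (expR (- z.1))%:E * (\1_(`]0%R, +oo[ : set R) z.1)%:E).
  have mh : measurable_fun setT h.
    apply: emeasurable_funM; last first.
      apply/measurable_EFinP; apply: (measurableT_comp _ measurable_fst).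
      exact: measurable_indic.
    apply: emeasurable_funM.
      apply: measurableT_comp => //.
      by apply: measurable_funD; [exact: measurable_fst|exact: measurable_snd].
    by apply/measurable_EFinP; exact: (measurableT_comp measurable_expRN measurable_fst).
  have h0 z : 0 <= h z by rewrite /h !mule_ge0 ?lee_fin ?expR_ge0.
  have := @measurable_fun_fubini_tonelli_G _ _ (measurableTypeR R) (measurableTypeR R) R mu h mh h0.
  apply: eq_measurable_fun => s _; rewrite /fubini_G; apply: eq_integral => u _.
  by rewrite patchE /h/= indicE; case: ifPn => _; rewrite ?mule1 ?mule0.
- by move=> s; apply: integral_ge0 => u _; rewrite mule_ge0// lee_fin expR_ge0.
exact: ge0_integral_convolution_expRN.
Qed.

Lemma ge0_integral_gaussian_sqnorm n d (T : measurableType d) (P : probability T R)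
    (X : 'I_n.+1 * bool -> T -> R) (f : R -> \bar R) :
  gaussian_on P predT X -> measurable_fun setT f -> (forall s, 0 <= f s) ->
  \int[P]_w f (\sum_(i < n.+1) (X (i, false) w ^+ 2 + X (i, true) w ^+ 2))%R =
  \int[mu]_(x in `]0%R, +oo[) (f x * (gamma_pdf n x)%:E).
Proof.
move=> gX mf f0; apply: (gaussian_sqnorm_aux (G := (N \x N))) => //.
- by move=> I k l; exact: gaussian_on_pair.
- by move=> g mg g0; exact: ge0_integral_gauss2_sqn2.
Qed.

End chi2.

(** * The Basel sum *)

Section basel.
Context (R : realType).
Implicit Types x : R.

Lemma sin_ltx x : 0 < x -> x < pi / 2 -> sin x < x.
Proof.
move=> x0 xp.
have [|c] := @MVT R (@sin R) (@cos R) 0 x x0.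
  by apply: continuous_subspaceT; exact: continuous_sin.
rewrite in_itv/= => /andP[c0 cx].
rewrite sin0 !subr0 => ->.
rewrite gtr_pMl// -cos0 ltr_cos// in_itv/=.
- by rewrite lexx pi_ge0.
- rewrite (ltW c0)/= ltW//; apply: lt_trans cx _; apply: lt_trans xp _.
  by rewrite gtr_pMr ?pi_gt0// invf_lt1 ?ltr1n.
Qed.

Lemma ltx_tan x : 0 < x -> x < pi / 2 -> x < tan x.
Proof.
move=> x0 xp.
have cp y : 0 <= y -> y <= x -> 0 < cos y.
  move=> y0 yx; apply: cos_gt0_pihalf; rewrite (le_lt_trans yx xp) andbT.
  by apply: lt_le_trans y0; rewrite oppr_lt0 divr_gt0 ?pi_gt0.
have [| |c] := @MVT R (@tan R) (fun y => (cos y) ^- 2) 0 x x0.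
- move=> y /[!in_itv]/= /andP[y0 yx]; apply: is_derive_tan.
  by rewrite gt_eqF// cp// ltW.
- apply: continuous_in_subspaceT => y /[!inE]/= /[!in_itv]/= /andP[y0 yx].
  by apply: continuous_tan; rewrite gt_eqF// cp.
rewrite in_itv/= => /andP[c0 cx].
rewrite tan0 !subr0 => ->.
have h := cp c (ltW c0) (ltW cx).
rewrite ltr_pMl// invf_gt1 ?exprn_gt0//.
rewrite expr_lt1// ?ltW//.
rewrite -cos0 ltr_cos// ?in_itv/= ?lexx ?pi_ge0//.
rewrite (ltW c0)/= ltW//; apply: lt_trans cx _; apply: lt_trans xp _.
by rewrite gtr_pMr ?pi_gt0// invf_lt1 ?ltr1n.
Qed.

(* Hofbauer's proof of Basel iterates this identity from [x = pi / 2]. *)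
Lemma invsin2_half x : sin x != 0 ->
  (sin x) ^- 2 = 4^-1 * ((sin (x / 2)) ^- 2 + (sin (pi / 2 - x / 2)) ^- 2).
Proof.
move=> sx.
have e : sin x = 2 * (cos (x / 2) * sin (x / 2)).
  by rewrite mulr_natl -sin_mulr2n -(mulr_natr (x / 2) 2) divfK// pnatr_eq0.
have s2 : sin (x / 2) != 0 by apply: contraNneq sx => h; rewrite e h !mulr0.
have c2 : cos (x / 2) != 0 by apply: contraNneq sx => h; rewrite e h mul0r mulr0.
have -> : sin (pi / 2 - x / 2) = cos (x / 2).
  by rewrite -opprB sinN sinBpihalf opprK.
have h : sin (x / 2) ^- 2 + cos (x / 2) ^- 2 = (sin (x / 2) * cos (x / 2)) ^- 2.
  move: (cos2Dsin2 (x / 2)) s2 c2; move: (cos _) (sin (x / 2)) => c s h0 s0 c0.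
  transitivity ((c ^+ 2 + s ^+ 2) * (s * c) ^- 2); last by rewrite h0 mul1r.
  by field; rewrite s0 c0.
by rewrite h e; field; rewrite s2 c2.
Qed.

(** The angles are the odd multiples of pi / 2^(n+2) below pi / 2. Halving sends this set to the
    next one, two angles for each old one, and multiplies the sum by 4; at n = 0 the only angle is
    pi / 4. *)
Lemma sum_invsin2 n :
  \sum_(k < 2 ^ n) (sin ((2 * k + 1)%:R * pi / (2 ^ n.+2)%:R)) ^- 2 = 4 ^+ n.+1 / 2 :> R.
Proof.
elim: n => [|n IH].
  rewrite expn0 big_ord1 /= muln0 add0n.
  have h : (sin (pi / 4 : R)) ^+ 2 = 2^-1.
    have := cos_mulr2n (pi / 4 : R); rewrite -(mulr_natr (pi / 4) 2).
    have -> : pi / 4 * 2 = pi / 2 :> R by field.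
    rewrite cos_pihalf cos2sin2 -(mulr_natr _ 2) => h.
    by apply: (@mulIf _ 2) => //; rewrite mulVf//; move: h; lra.
  have -> : 1%:R * pi / (2 ^ 2)%:R = pi / 4 :> R by rewrite mul1r.
  by rewrite h invrK expr1; field.
pose F m k : R := (sin ((2 * k + 1)%:R * pi / (2 ^ m)%:R)) ^- 2.
(* The angle pi / 2 - x / 2 is again an odd multiple of the finer unit; this is its index. *)
have FS (k : nat) : (k < 2 ^ n)%N ->
    F n.+3 k + F n.+3 (2 ^ n.+1 - k.+1)%N = 4 * F n.+2 k.
  move=> kn; rewrite /F; set x := _ * _ / (2 ^ n.+2)%:R.
  have n0 : (2 ^ n)%:R != 0 :> R by rewrite pnatr_eq0 expn_eq0.
  have e1 : (2 * k + 1)%:R * pi / (2 ^ n.+3)%:R = x / 2.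
    by rewrite /x (expnS _ n.+2) natrM; field; rewrite expnS natrM expnS natrM !mulf_neq0.
  have e2 : (2 * (2 ^ n.+1 - k.+1) + 1)%:R * pi / (2 ^ n.+3)%:R = pi / 2 - x / 2.
    have -> : (2 * (2 ^ n.+1 - k.+1) + 1)%N = (2 ^ n.+2 - (2 * k + 1))%N.
      have : (k.+1 <= 2 ^ n.+1)%N by rewrite (leq_trans kn)// leq_exp2l.
      by rewrite (expnS _ n.+1); lia.
    rewrite natrB; last first.
      by have : (k.+1 <= 2 ^ n)%N := kn; rewrite !expnS; lia.
    by rewrite /x (expnS _ n.+2) (expnS _ n.+1) !natrM; field; rewrite expnS natrM mulf_neq0.
  rewrite e1 e2 (@invsin2_half x); first by rewrite mulrA mulfV ?mul1r// pnatr_eq0.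
  rewrite gt_eqF// sin_gt0_pi// /x; apply/andP; split.
    by rewrite divr_gt0 ?mulr_gt0 ?pi_gt0 ?ltr0n ?addn1 ?expn_gt0.
  rewrite mulrAC gtr_pMl ?pi_gt0// ltr_pdivrMr ?ltr0n ?expn_gt0// mul1r ltr_nat.
  by have : (k.+1 <= 2 ^ n)%N := kn; rewrite !expnS; lia.
have -> : (2 ^ n.+1)%N = (2 ^ n + 2 ^ n)%N by rewrite expnS mul2n addnn.
(* Read backwards, the upper half of the indices runs through the partners of the lower half. *)
rewrite big_split_ord/= [X in _ + X](reindex_inj rev_ord_inj)/= -big_split/=.
rewrite (eq_bigr (fun k : 'I_(2 ^ n) => 4 * F n.+2 k)).
  by rewrite -mulr_sumr IH mulrA -exprS.
move=> k _; rewrite -FS//; congr (_ + F _ _).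
by rewrite addnBA// addnn -mul2n -expnS.
Qed.

(** From sin x < x < tan x, since 1 / tan^2 x = 1 / sin^2 x - 1. *)
Lemma invsqr_bounds x : 0 < x -> x < pi / 2 -> (sin x) ^- 2 - 1 <= x ^- 2 <= (sin x) ^- 2.
Proof.
move=> x0 xp.
have s0 : 0 < sin x by apply: sin_gt0_pihalf; rewrite x0.
have c0 : 0 < cos x.
  by apply: cos_gt0_pihalf; rewrite xp andbT (lt_trans _ x0)// oppr_lt0 divr_gt0 ?pi_gt0.
have t0 : 0 < tan x by rewrite divr_gt0.
apply/andP; split; last first.
  by rewrite lef_pV2 ?posrE ?exprn_gt0// ler_sqr ?nnegrE ?ltW// sin_ltx.
have -> : (sin x) ^- 2 - 1 = (tan x) ^- 2.
  rewrite /tan expr_div_n invf_div cos2sin2 mulrBl mul1r divff//.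
  by rewrite expf_neq0// gt_eqF.
by rewrite lef_pV2 ?posrE ?exprn_gt0// ler_sqr ?nnegrE ?ltW// ltx_tan.
Qed.

(** Each of the 2^n terms is off by at most 1 in [invsqr_bounds], and the angles carry the scale
    factor 16 * 4^n / pi^2; dividing the total error 2^n by it gives the bound. *)
Lemma sum_odd_invsqr_bounds n :
  `|pi ^+ 2 / 8 - \sum_(k < 2 ^ n) (2 * k + 1)%:R ^- 2| <= (pi ^+ 2 / 16) / (2 ^ n)%:R :> R.
Proof.
set O := \sum_(k < _) _.
have n0 : 0 < (2 ^ n)%:R :> R by rewrite ltr0n expn_gt0.
have p0 : 0 < (pi : R) := pi_gt0 R.
have e4 : 4 ^+ n.+1 = 4 * (2 ^ n)%:R ^+ 2 :> R.
  have -> : 4 = 2 ^+ 2 :> R by rewrite -natrX.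
  by rewrite exprS natrX -!exprM mulnC.
have OE : \sum_(k < 2 ^ n) ((2 * k + 1)%:R * pi / (2 ^ n.+2)%:R) ^- 2 =
    16 * (2 ^ n)%:R ^+ 2 / pi ^+ 2 * O.
  rewrite /O mulr_sumr; apply: eq_bigr => k _.
  have k0 : (2 * k + 1)%:R != 0 :> R by rewrite pnatr_eq0 addn1.
  move: k0; set K := (2 * k + 1)%:R; clearbody K => k0.
  rewrite !expnS !natrM; move: (lt0r_neq0 p0); move: (@pi R) => p p1; field.
  by rewrite k0 p1 gt_eqF.
have bnd (k : 'I_(2 ^ n)) : let x : R := (2 * k + 1)%:R * pi / (2 ^ n.+2)%:R in
    (sin x) ^- 2 - 1 <= x ^- 2 <= (sin x) ^- 2.
  move=> x; apply: invsqr_bounds; rewrite /x; first by rewrite divr_gt0 ?mulr_gt0 ?ltr0n ?addn1 ?expn_gt0.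
  rewrite mulrAC mulrC ltr_pM2l// ltr_pdivrMr ?ltr0n ?expn_gt0//.
  rewrite (expnS _ n.+1) natrM mulrA mulVf// mul1r ltr_nat expnS.
  by have := ltn_ord k; lia.
have up : 16 * (2 ^ n)%:R ^+ 2 / pi ^+ 2 * O <= 4 ^+ n.+1 / 2.
  by rewrite -OE -sum_invsin2; apply: ler_sum => k _; case/andP: (bnd k).
have lo : 4 ^+ n.+1 / 2 - (2 ^ n)%:R <= 16 * (2 ^ n)%:R ^+ 2 / pi ^+ 2 * O.
  rewrite -OE -sum_invsin2 -[X in _ - X%:R]card_ord -sumr_const -sumrB.
  by apply: ler_sum => k _; case/andP: (bnd k).
set M := (2 ^ n)%:R in n0 e4 OE up lo *; clearbody M O.
have c0 : 0 < 16 * M ^+ 2 / pi ^+ 2 by rewrite divr_gt0 ?mulr_gt0 ?exprn_gt0.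
rewrite ler_norml; apply/andP; split.
  have h : O <= pi ^+ 2 / 8.
    rewrite -(ler_pM2l c0) (le_trans up)// e4 le_eqVlt; apply/orP; left.
    apply/eqP; move: (lt0r_neq0 p0) (lt0r_neq0 n0); move: (@pi R) => p p1 n1; field.
    by rewrite ?p1 ?n1.
  apply: (@le_trans _ _ 0); first by rewrite oppr_le0 divr_ge0 ?divr_ge0 ?exprn_ge0 ?ltW.
  by rewrite subr_ge0.
rewrite lerBlDr -lerBlDl -(ler_pM2l c0) (le_trans _ lo)// e4 le_eqVlt; apply/orP; left.
apply/eqP; move: (lt0r_neq0 p0) (lt0r_neq0 n0); move: (@pi R) => p p1 n1; field.
by rewrite ?p1 ?n1.
Qed.

(** The even terms up to 2N make up a quarter of the sum up to N. The constant 1/4 in the error is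
    the fixed point of this recursion: a quarter of it plus 1/16 is its half, and the bound halves
    with each n. *)
Lemma sum_invsqr_dyadic n :
  `|pi ^+ 2 / 6 - \sum_(1 <= k < (2 ^ n).+1) k%:R ^- 2| <= (pi ^+ 2 / 4) / (2 ^ n)%:R :> R.
Proof.
have p4 : 4 <= pi ^+ 2 :> R.
  rewrite (_ : 4 = 2 ^+ 2); last by rewrite -natrX.
  by rewrite ler_sqr ?nnegrE ?pi_ge0// pi_ge2.
elim: n => [|n IH].
  rewrite expn0 big_nat1 mulr1n expr1n invr1 mulr1; rewrite ler_norml; apply/andP; split; lra.
have split2 N : \sum_(1 <= k < (N + N).+1) k%:R ^- 2 =
    4^-1 * (\sum_(1 <= k < N.+1) k%:R ^- 2) + \sum_(k < N) (2 * k + 1)%:R ^- 2 :> R.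
  elim: N => [|N IHN]; first by rewrite !big_nil big_ord0 mulr0 addr0.
  rewrite addSn addnS 2?big_nat_recr//= IHN big_ord_recr/= [in RHS]big_nat_recr//=.
  have -> : (N + N).+2 = (2 * N.+1)%N by lia.
  have -> : (N + N).+1 = (2 * N + 1)%N by lia.
  have -> : (2 * N.+1)%:R ^- 2 = 4^-1 * N.+1%:R ^- 2 :> R.
    by rewrite natrM exprMn invfM; congr (_^-1 * _); rewrite -natrX.
  set a := N.+1%:R ^- 2; set b := (2 * N + 1)%:R ^- 2.
  set S := \sum_(1 <= k < N.+1) _; set O := \sum_(k < N) _.
  by clearbody a b S O; ring.
have -> : (2 ^ n.+1)%N = (2 ^ n + 2 ^ n)%N by rewrite expnS mul2n addnn.
rewrite split2.
have := sum_odd_invsqr_bounds n; move: IH.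
set O := \sum_(k < _) _; set Z := \sum_(1 <= k < _) _.
rewrite natrD; set M := (2 ^ n)%:R.
have n0 : 0 < M by rewrite ltr0n expn_gt0.
clearbody Z O M => h1 h2.
have -> : pi ^+ 2 / 6 - (4^-1 * Z + O) = 4^-1 * (pi ^+ 2 / 6 - Z) + (pi ^+ 2 / 8 - O) by field.
apply: (le_trans (ler_normD _ _)).
rewrite normrM ger0_norm ?invr_ge0//.
apply: (le_trans (lerD (ler_wpM2l _ h1) h2)); first by rewrite invr_ge0.
rewrite le_eqVlt; apply/orP; left; apply/eqP.
move: (lt0r_neq0 n0); move: (@pi R) => p n1; field.
by rewrite -mulr2n mulrn_eq0 negb_or n1.
Qed.

(** The partial sums increase and are bounded along powers of 2, hence converge; the dyadic
    subsequence identifies the limit. *)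
Lemma cvg_sum_invsqr :
  \sum_(1 <= k < n.+1) k%:R ^- 2 @[n --> \oo] --> (pi ^+ 2 / 6 : R).
Proof.
pose Z n : R := \sum_(1 <= k < n.+1) k%:R ^- 2.
have ndZ : nondecreasing_seq Z.
  apply/nondecreasing_seqP => n; rewrite /Z [leRHS]big_nat_recr//= lerDl.
  by rewrite invr_ge0 exprn_ge0.
have Zd n : Z (2 ^ n)%N <= pi ^+ 2 / 6 + pi ^+ 2 / 4.
  have := sum_invsqr_dyadic n; rewrite -/(Z _) ler_norml => /andP[+ _].
  rewrite lerNl opprB lerBlDl => /le_trans; apply; rewrite lerD2l.
  by rewrite ler_pdivrMr ?ltr0n ?expn_gt0// ler_peMr ?ler1n ?expn_gt0// divr_ge0 ?exprn_ge0 ?pi_ge0.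
have cZ : cvgn Z.
  apply: nondecreasing_is_cvgn => //; exists (pi ^+ 2 / 6 + pi ^+ 2 / 4) => _ [n _ <-].
  by apply: le_trans (Zd n); apply: ndZ; rewrite ltnW// ltn_expl.
have pow2 : (2 ^ n)%N @[n --> \oo] --> \oo.
  by apply/cvgnyPge => m; near=> n; apply: (@leq_trans n); [near: n; exists m|rewrite ltnW// ltn_expl].
have h1 : Z (2 ^ n)%N @[n --> \oo] --> limn Z by apply: (cvg_comp _ _ pow2 cZ).
have h2 : Z (2 ^ n)%N @[n --> \oo] --> (pi ^+ 2 / 6 : R).
  apply/cvgrPdist_le => e e0; near=> n.
  apply: le_trans (sum_invsqr_dyadic n) _.
  rewrite ler_pdivrMr ?ltr0n ?expn_gt0// -ler_pdivrMl// mulrC.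
  apply: (@le_trans _ _ n%:R); last by rewrite ler_nat ltnW// ltn_expl.
  by near: n; exact: nbhs_infty_ger.
by rewrite -(cvg_unique _ h1 h2).
Unshelve. all: by end_near. Qed.

End basel.

(** * Logarithmic moments of the Gamma law *)

Section harmonic.
Context {R : realType}.

Definition harm (n : nat) : R := \sum_(1 <= k < n.+1) k%:R^-1.

Lemma harmS n : harm n.+1 = harm n + n.+1%:R^-1.
Proof. by rewrite /harm big_nat_recr. Qed.

Lemma ln_le_harm n : ln n.+1%:R <= harm n.
Proof.
elim: n => [|n IH]; first by rewrite ln1 /harm big_nil.
rewrite harmS.
have -> : n.+2%:R = n.+1%:R * (1 + n.+1%:R^-1) :> R.
  by rewrite mulrDr mulr1 divff ?pnatr_eq0// natr1.
rewrite lnM; [|by rewrite posrE ltr0n|by rewrite posrE ltr_pwDl// invr_ge0].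
by rewrite lerD// le_ln1Dx// (lt_trans (ltrN10 _))// invr_gt0 ltr0n.
Qed.

(** A [limn] denotes the limit only if there is one: here a decreasing sequence that is bounded
    below because ln (n + 1) is at most the n-th harmonic number. *)
Lemma cvg_euler_gamma : harm n - ln n%:R @[n --> \oo] --> euler_gamma R.
Proof.
pose u n : R := harm n - ln n%:R.
suff h : cvgn u by exact: h.
(* The shift avoids index 0, where the convention [ln 0 = 0] gives [u 0 = 0 < u 1] and breaks
   monotonicity. *)
suff : cvgn (fun n => u n.+1) by move=> /cvg_ex[l ul]; apply/cvg_ex; exists l; rewrite -cvg_shiftS.
apply: nonincreasing_is_cvgn.
  apply/nonincreasing_seqP => n.
  have e : n.+1%:R = n.+2%:R * (1 + (- n.+2%:R^-1)) :> R.
    by rewrite mulrDr mulr1 mulrN divff ?pnatr_eq0// -[n.+2%:R]natr1 addrK.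
  have h : 0 < 1 + (- n.+2%:R^-1) :> R.
    by rewrite subr_gt0 invf_lt1 ?ltr0n// ltr1n.
  have l : ln n.+1%:R = ln n.+2%:R + ln (1 + (- n.+2%:R^-1)) :> R.
    by rewrite {1}e lnM ?posrE ?ltr0n.
  have : ln (1 + (- n.+2%:R^-1)) <= - n.+2%:R^-1 :> R.
    by apply: le_ln1Dx; rewrite ltrN2 invf_lt1 ?ltr0n// ltr1n.
  rewrite /u (harmS n.+1) l; move: (ln (1 + _)) => l1; move: (ln _) => l2.
  by move: (n.+2%:R^-1) (harm _) => i H hl; lra.
exists 0 => _ [n _ <-]; rewrite /u harmS subr_ge0.
by apply: le_trans (ln_le_harm n) _; rewrite lerDl invr_ge0.
Qed.

End harmonic.

Section gamma_log.
Context {R : realType}.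
Local Notation mu := (@lebesgue_measure R).

(** Integration by parts in Tonelli form: exp (- x) is the integral of exp (- y) over y > x, and
    exchanging the integrals replaces f x * x^n / n! by its primitive. *)
Lemma gamma_pdf_step n (f g : R -> \bar R) :
  measurable_fun setT f -> (forall x, 0 <= f x)%E ->
  (forall y : R, (0 < y)%R -> \int[mu]_(x in `]0%R, y[) (f x * (x ^+ n / n`!%:R)%:E) =
                     g y * (y ^+ n.+1 / n.+1`!%:R)%:E)%E ->
  (\int[mu]_(x in `]0%R, +oo[) (f x * (gamma_pdf n x)%:E) =
   \int[mu]_(x in `]0%R, +oo[) (g x * (gamma_pdf n.+1 x)%:E))%E.
Proof.
move=> mf f0 fg.
pose a (x : R) : \bar R := (f x * (`|x| ^+ n / n`!%:R)%:E)%E.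
pose b (y : R) : \bar R := (expR (- y))%:E.
have ma : measurable_fun setT a.
  apply: emeasurable_funM => //; apply/measurable_EFinP; apply: measurable_funM => //.
  by apply: measurable_funX; exact: normr_measurable.
have a0 x : (0 <= a x)%E by rewrite mule_ge0// lee_fin divr_ge0// exprn_ge0.
have mb : measurable_fun setT b by apply/measurable_EFinP; exact: measurable_expRN.
have b0 x : (0 <= b x)%E by rewrite lee_fin expR_ge0.
have := ge0_tonelli_triangle ma a0 mb b0.
have -> : (\int[mu]_(x in `]0%R, +oo[) (a x * \int[mu]_(y in `]x, +oo[) b y) =
    \int[mu]_(x in `]0%R, +oo[) (f x * (gamma_pdf n x)%:E))%E.
  apply: eq_integral => x; rewrite inE/= in_itv/= andbT => x0.
  rewrite integral_itv_obnd_cbnd; last exact: measurable_funTS.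
  rewrite integral_expRN /a ger0_norm ?ltW// -muleA -EFinM; congr (_ * _%:E)%E.
  by rewrite /gamma_pdf; ring.
move=> ->; apply: eq_integral => y; rewrite inE/= in_itv/= andbT => y0.
have -> : (\int[mu]_(x in `]0%R, y[) a x = g y * (y ^+ n.+1 / n.+1`!%:R)%:E)%E.
  rewrite -fg//; apply: eq_integral => x; rewrite inE/= in_itv/= => /andP[x0 _].
  by rewrite /a ger0_norm// ltW.
by rewrite /b muleCA -EFinM; congr (_ * _%:E)%E; rewrite /gamma_pdf; ring.
Qed.

Lemma integral_gamma_pdf n : (\int[mu]_(x in `]0%R, +oo[) (gamma_pdf n x)%:E = 1)%E.
Proof.
elim: n => [|n IH].
  transitivity (\int[mu]_(x in `[0%R, +oo[) (expR (- x))%:E)%E; last first.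
    by rewrite integral_expRN oppr0 expR0.
  rewrite -integral_itv_obnd_cbnd; last first.
    by apply: measurable_funTS; apply/measurable_EFinP; exact: measurable_expRN.
  by apply: eq_integral => x _; rewrite /gamma_pdf expr0 mul1r fact0 divr1.
have st := @gamma_pdf_step n (cst 1%E) (cst 1%E) (measurable_cst _) (fun=> lee01).
have e m : (\int[mu]_(x in `]0%R, +oo[) (gamma_pdf m x)%:E =
    \int[mu]_(x in `]0%R, +oo[) (cst 1 x * (gamma_pdf m x)%:E))%E.
  by apply: eq_integral => x _; rewrite mul1e.
rewrite e -st -?e// => y y0; rewrite mul1e -integral_exprn_fact//.
by apply: eq_integral => x _; rewrite mul1e.
Qed.

Local Notation c n := (n.+1%:R^-1 : R).

(** The primitive of (ln x - a)^2 * x^n / n! that tends to 0 at 0. Two integrations by parts give a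
    quadratic in ln x - a; completing the square leaves the constant 1 / (n+1)^2. *)
Let Phi n a (x : R) : R :=
  (x ^+ n.+1 / n.+1`!%:R) * (c n ^+ 2 + (ln x - a - c n) ^+ 2).

Let is_derive_Phi n a (x : R) : 0 < x ->
  is_derive x (1 : R) (Phi n a) ((ln x - a) ^+ 2 * (x ^+ n / n`!%:R)).
Proof.
move=> x0.
have dX := is_derive_exprn n.+1 x.
have dl := is_derive1_ln x0.
have -> : Phi n a = (n.+1`!%:R^-1 \*: (fun x : R => x ^+ n.+1)) *
    (cst (c n ^+ 2) + ((@ln R) - cst (a + c n)) ^+ 2).
  by apply/funext => z; rewrite /Phi [_ / _]mulrC -addrA -opprD.
apply: is_derive_eq; rewrite /GRing.scale/= factS natrM.
have n0 : n`!%:R != 0 :> R by rewrite pnatr_eq0 -lt0n fact_gt0.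
have n1 : n.+1%:R != 0 :> R by rewrite pnatr_eq0.
rewrite fctE /cst/= exprS; move: n0 n1; set F := n`!%:R; set m := n.+1%:R => n0 n1.
have xn0 : x != 0 by rewrite gt_eqF.
rewrite !fctE /GRing.scale/= expr1.
clearbody F m.
field.
by rewrite n0 n1 xn0.
Qed.

Let Phi_ge0 n a x : 0 <= x -> 0 <= Phi n a x.
Proof. by move=> x0; rewrite mulr_ge0 ?addr_ge0 ?sqr_ge0// divr_ge0 ?exprn_ge0. Qed.

Let continuous_lnsq n a (x : R) : 0 < x ->
  {for x, continuous (fun x : R => (ln x - a) ^+ 2 * (x ^+ n / n`!%:R))}.
Proof.
move=> x0; apply: cvgM; last first.
  by apply: cvgM; [exact: exprn_continuous|exact: cvg_cst].
apply: (@cvg_comp _ _ _ (fun x : R => ln x - a) (fun z : R => z ^+ 2)); last exact: exprn_continuous.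
by apply: cvgB; [exact: continuous_ln|exact: cvg_cst].
Qed.

Let integral_lnsq_cc n a (e y : R) : 0 < e -> e < y ->
  (\int[mu]_(x in `[e, y]) ((ln x - a) ^+ 2 * (x ^+ n / n`!%:R))%:E =
   (Phi n a y)%:E - (Phi n a e)%:E)%E.
Proof.
move=> e0 ey.
have dP x : e <= x -> is_derive x (1 : R) (Phi n a) ((ln x - a) ^+ 2 * (x ^+ n / n`!%:R)).
  by move=> ex; apply: is_derive_Phi; exact: lt_le_trans ex.
have cP x : e <= x -> {for x, continuous (Phi n a)}.
  move=> ex; apply/differentiable_continuous/derivable1_diffP.
  exact: (@ex_derive _ _ _ _ _ _ _ (dP x ex)).
rewrite (@continuous_FTC2 _ _ (Phi n a))//.
- apply: continuous_in_subspaceT => x /[!inE]/= /[!in_itv]/= /andP[ex _].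
  by apply: continuous_lnsq; exact: lt_le_trans ex.
- split.
  + move=> x /[!in_itv]/= /andP[ex _].
    exact: (@ex_derive _ _ _ _ _ _ _ (dP x (ltW ex))).
  + by apply/cvg_at_right_filter; exact: cP.
  + by apply/cvg_at_left_filter; apply: cP; exact: ltW.
- move=> x /[!in_itv]/= /andP[ex _]; rewrite derive1E.
  exact: (@derive_val _ _ _ _ _ _ _ (dP x (ltW ex))).
Qed.

Lemma measurable_lnsq a : measurable_fun setT (fun x : R => ((ln x - a) ^+ 2)%:E).
Proof.
apply/measurable_EFinP; apply: measurable_funX; apply: measurable_funB => //.
Qed.

Lemma integral_lnsq n a (y : R) : 0 < y ->
  (\int[mu]_(x in `]0%R, y[) (((ln x - a) ^+ 2)%:E * (x ^+ n / n`!%:R)%:E) =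
   (c n ^+ 2 + (ln y - a - c n) ^+ 2)%:E * (y ^+ n.+1 / n.+1`!%:R)%:E)%E.
Proof.
move=> y0; rewrite -EFinM [in RHS]mulrC -/(Phi n a y).
pose h (x : R) : \bar R := (((ln x - a) ^+ 2)%:E * (x ^+ n / n`!%:R)%:E)%E.
have mh : measurable_fun setT h.
  apply: emeasurable_funM; first exact: measurable_lnsq.
  apply/measurable_EFinP; apply: measurable_funM => //.
(* Lower endpoints tending to 0 at which the logarithm is explicit, equal to ln y - (k + 1). *)
pose e k : R := y * expR (- k.+1%:R).
have e0 k : 0 < e k by rewrite mulr_gt0// expR_gt0.
have ey k : e k < y by rewrite gtr_pMr// expR_lt1 oppr_lt0 ltr0n.
have mF k : measurable (`[e k, y]%classic : set R) by [].
have ndF : nondecreasing_seq (fun k => `[e k, y]%classic : set R).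
  apply/nondecreasing_seqP => k; rewrite subsetEset; apply: subset_itvr.
  by rewrite bnd_simp ler_pM2l// ler_expR lerN2 ler_nat.
have UF : \bigcup_k `[e k, y]%classic = `]0%R, y]%classic.
  apply/seteqP; split => [x [k _]|x] /=; rewrite !in_itv/=.
    by move=> /andP[ekx ->]; rewrite andbT (lt_le_trans _ ekx).
  (* With m the successor of this index, m > y / x, and exp m >= 1 + m puts [x] to the right of the
     endpoint. *)
  move=> /andP[x0 xy]; exists (Num.truncn (y / x)) => //=; rewrite in_itv/= xy andbT.
  rewrite /e expRN ler_pdivrMr ?expR_gt0// -ler_pdivrMl// mulrC.
  apply: (le_trans (ltW (truncnS_gt _))).
  by apply: le_trans (expR_ge1Dx _); rewrite lerDr.
rewrite (_ : \int[mu]_(x in _) _ = \int[mu]_(x in `]0%R, y]) h x)%E; last first.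
  by rewrite -(@integral_itv_bndoo _ 0 y h false false)//; exact: measurable_funTS.
rewrite -UF.
have h0 x : 0 < x -> (0 <= h x)%E.
  by move=> x0; rewrite mule_ge0 ?lee_fin ?sqr_ge0// divr_ge0 ?exprn_ge0// ltW.
have cv := @ge0_nondecreasing_set_cvg_integral _ (measurableTypeR R) R (fun k => `[e k, y]%classic) h mu ndF mF
  (fun k => measurable_funTS mh).
have {}cv := cv (fun k x ekx => h0 x (lt_le_trans (e0 k) (elimT andP ekx).1)).
suff cv2 : (fun k => (Phi n a y)%:E - (Phi n a (e k))%:E)%E @ \oo --> (Phi n a y)%:E.
  apply: (cvg_unique _ cv) => //.
  rewrite (_ : (fun k => _) = (fun k => (Phi n a y)%:E - (Phi n a (e k))%:E)%E)//.
  by apply/funext => k; exact: (integral_lnsq_cc n a (e0 k) (ey k)).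
rewrite -[X in _ --> X]sube0; apply: cvgeB => //; first exact: cvg_cst.
apply: cvg_EFin; first exact: nearW.
(* Chosen so that the bracket in [Phi] at [e k] is at most K * (k + 1)^2. *)
pose K : R := c n ^+ 2 + (1 + `|ln y - a - c n|) ^+ 2.
have K0 : 0 <= K by rewrite addr_ge0 ?sqr_ge0.
apply: (@squeeze_cvgr _ _ _ _ (cst 0) (fun k => (y ^+ n.+1 * K * 6) * k.+1%:R^-1)).
- apply: nearW => k; rewrite Phi_ge0 ?(ltW (e0 k))//= /Phi /e.
  rewrite lnM ?posrE ?expR_gt0// expRK.
  have k0 : 0 < k.+1%:R :> R by rewrite ltr0n.
  have b1 : c n ^+ 2 + (ln y - k.+1%:R - a - c n) ^+ 2 <= K * k.+1%:R ^+ 2.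
    rewrite mulrDl lerD//.
      by rewrite ler_peMr ?sqr_ge0// exprn_ege1// ler1n.
    rewrite -exprMn -[leLHS]real_normK ?num_real// ler_sqr ?nnegrE ?mulr_ge0 ?addr_ge0//.
    have -> : ln y - k.+1%:R - a - c n = (ln y - a - c n) - k.+1%:R by ring.
    apply: le_trans (ler_normB _ _) _.
    rewrite [`|k.+1%:R|]ger0_norm ?ler0n// mulrDl mul1r addrC lerD2l.
    by rewrite ler_peMr// ler1n.
  (* The cubic term of the exponential series, 6 = 3!: one power more than the quadratic growth in
     [b1], which leaves a bound of order 1 / (k + 1). *)
  have b2 : expR (- k.+1%:R) <= 6 / k.+1%:R ^+ 3 :> R.
    rewrite expRN -invf_div lef_pV2 ?posrE ?expR_gt0 ?divr_gt0 ?exprn_gt0//.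
    have := @expR_ge1Dxn R k.+1%:R 2 (ltW k0).
    by apply: le_trans; rewrite lerDr.
  have b3 : (y * expR (- k.+1%:R)) ^+ n.+1 / n.+1`!%:R <= y ^+ n.+1 * expR (- k.+1%:R).
    rewrite ler_pdivrMr ?ltr0n ?fact_gt0// exprMn -mulrA ler_pM2l ?exprn_gt0//.
    apply: (@le_trans _ _ (expR (- k.+1%:R))); last first.
      by rewrite ler_peMr ?expR_ge0// ler1n fact_gt0.
    have e1 : expR (- k.+1%:R) <= 1 :> R by rewrite expR_le1 oppr_le0 ler0n.
    by rewrite exprS ler_piMr ?expR_ge0// exprn_ile1 ?expR_ge0.
  apply: (@le_trans _ _ ((y ^+ n.+1 * (6 / k.+1%:R ^+ 3)) * (K * k.+1%:R ^+ 2))).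
    apply: ler_pM => //.
    - by rewrite divr_ge0// exprn_ge0// mulr_ge0 ?expR_ge0// ltW.
    - by rewrite addr_ge0 ?sqr_ge0.
    - by apply: le_trans b3 _; rewrite ler_pM2l ?exprn_gt0.
  rewrite le_eqVlt; apply/orP; left; apply/eqP; move: k0.
  move: (k.+1%:R) (y ^+ n.+1) K {K0 b1} => m z K m0.
  by field; rewrite gt_eqF.
- exact: cvg_cst.
- rewrite -[X in _ --> X](mulr0 (y ^+ n.+1 * K * 6)).
  by apply: cvgM; [exact: cvg_cst|exact: cvg_harmonic].
Qed.

End gamma_log.

Section gamma_log_moments.
Context {R : realType}.
Local Notation mu := (@lebesgue_measure R).
Local Notation c n := (n.+1%:R^-1 : R).

(** Second moment about [a] of the logarithm of a Gamma variable of shape [n.+1], extended-valued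
    because its finiteness is established only in [integral_ln_gamma]. *)
Let Q n a : \bar R :=
  (\int[mu]_(x in `]0%R, +oo[) (((ln x - a) ^+ 2)%:E * (gamma_pdf n x)%:E))%E.

Let measurable_gamma_pdfE n (D : set R) : measurable_fun D (fun x => (gamma_pdf n x)%:E).
Proof. by apply: measurable_funTS; apply/measurable_EFinP; exact: measurable_gamma_pdf. Qed.

Let gamma_pdf0 n (x : R) : x \in `]0%R, +oo[%classic -> 0 <= gamma_pdf n x.
Proof. by rewrite inE/= in_itv/= andbT => x0; rewrite gamma_pdf_ge0// ltW. Qed.

Let lnsq_gamma0 n a (x : R) : `]0%R, +oo[%classic x ->
  (0 <= ((ln x - a) ^+ 2)%:E * (gamma_pdf n x)%:E)%E.
Proof. by move=> x0; rewrite mule_ge0 ?lee_fin ?sqr_ge0// gamma_pdf0// inE. Qed.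

Let affine_gamma n (k l : R) (f : R -> R) : 0 <= k -> 0 <= l ->
  measurable_fun setT f -> (forall x, 0 < x -> 0 <= f x) ->
  (\int[mu]_(x in `]0%R, +oo[) ((k + l * f x)%:E * (gamma_pdf n x)%:E) =
   k%:E + l%:E * \int[mu]_(x in `]0%R, +oo[) ((f x)%:E * (gamma_pdf n x)%:E))%E.
Proof.
move=> k0 l0 mf f0.
have fx (x : R) : `]0%R, +oo[%classic x -> 0 <= f x by rewrite /= in_itv/= andbT => /f0.
have gx (x : R) : `]0%R, +oo[%classic x -> 0 <= gamma_pdf n x.
  by move=> x0; rewrite gamma_pdf0// inE.
have mfg : measurable_fun (`]0%R, +oo[%classic : set R) (fun x => (f x)%:E * (gamma_pdf n x)%:E)%E.
  by apply: emeasurable_funM => //; apply: measurable_funTS; exact/measurable_EFinP.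
have mg : measurable_fun (`]0%R, +oo[%classic : set R) (fun x => (gamma_pdf n x)%:E).
  exact: measurable_gamma_pdfE.
have g0 (x : R) : `]0%R, +oo[%classic x -> (0 <= (gamma_pdf n x)%:E)%E.
  by move=> x0; rewrite lee_fin gx.
have fg0 (x : R) : `]0%R, +oo[%classic x -> (0 <= (f x)%:E * (gamma_pdf n x)%:E)%E.
  by move=> x0; rewrite mule_ge0 ?lee_fin ?fx ?gx.
rewrite -[k%:E]mule1 -{1}(integral_gamma_pdf n) -!ge0_integralZl//.
have kg0 (x : R) : `]0%R, +oo[%classic x -> (0 <= k%:E * (gamma_pdf n x)%:E)%E.
  by move=> x0; rewrite mule_ge0 ?lee_fin ?gx.
have lfg0 (x : R) : `]0%R, +oo[%classic x -> (0 <= l%:E * ((f x)%:E * (gamma_pdf n x)%:E))%E.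
  by move=> x0; rewrite mule_ge0 ?fg0.
have mkg : measurable_fun (`]0%R, +oo[%classic : set R) (fun x => k%:E * (gamma_pdf n x)%:E)%E.
  exact: emeasurable_funM.
have mlfg : measurable_fun (`]0%R, +oo[%classic : set R)
    (fun x => l%:E * ((f x)%:E * (gamma_pdf n x)%:E))%E.
  exact: emeasurable_funM.
rewrite -ge0_integralD//.
by apply: eq_integral => x _; rewrite muleA -!EFinM -EFinD mulrDl.
Qed.

Let measurable_lnsqR a : measurable_fun setT (fun x : R => (ln x - a) ^+ 2).
Proof. by apply/measurable_EFinP; exact: measurable_lnsq. Qed.

Let measurable_mul_gamma n (f : R -> R) : measurable_fun setT f ->
  measurable_fun (`]0%R, +oo[%classic : set R) (fun x => (f x)%:E * (gamma_pdf n x)%:E)%E.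
Proof.
move=> mf; apply: emeasurable_funM; last exact: measurable_gamma_pdfE.
by apply: measurable_funTS; exact/measurable_EFinP.
Qed.

Let measurable_affine_lnsq (k l : R) a : measurable_fun setT (fun x : R => k + l * (ln x - a) ^+ 2).
Proof.
by apply: measurable_funD => //; apply: measurable_funM => //; exact: measurable_lnsqR.
Qed.

Let affine_Q n (k l : R) a : 0 <= k -> 0 <= l ->
  (\int[mu]_(x in `]0%R, +oo[) ((k + l * (ln x - a) ^+ 2)%:E * (gamma_pdf n x)%:E) =
   k%:E + l%:E * Q n a)%E.
Proof.
move=> k0 l0; apply: (affine_gamma n k0 l0 (measurable_lnsqR a)) => x _.
exact: sqr_ge0.
Qed.

Let Q_rec n a : Q n a = ((c n ^+ 2)%:E + Q n.+1 (a + c n))%E.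
Proof.
rewrite /Q (gamma_pdf_step (g := fun y => (c n ^+ 2 + (ln y - a - c n) ^+ 2)%:E)).
- rewrite -[X in (_ + X)%E]mul1e -affine_Q ?sqr_ge0//.
  by apply: eq_integral => x _; rewrite mul1r opprD addrA.
- exact: measurable_lnsq.
- by move=> x; rewrite lee_fin sqr_ge0.
- by move=> y y0; exact: integral_lnsq.
Qed.

Let Z n : R := \sum_(1 <= k < n.+1) k%:R ^- 2.

Let Q_iter n m a : (Q n a = (Z (n + m) - Z n)%:E + Q (n + m) (a + harm (n + m) - harm n))%E.
Proof.
elim: m => [|m IH]; first by rewrite addn0 subrr add0e addrK.
rewrite IH Q_rec addeA -EFinD addnS; congr (_%:E + Q _ _)%E.
  by rewrite /Z [in RHS]big_nat_recr//= exprVn; ring.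
by rewrite harmS; ring.
Qed.

(* This is [2 cosh u - 2 >= u ^ 2] at [u = ln x]. *)
Let ln_sqr_le (x : R) : 0 < x -> ln x ^+ 2 + 2 <= x + x^-1.
Proof.
have pos (u : R) : 0 <= u -> u ^+ 2 + 2 <= expR u + expR (- u).
  rewrite le_eqVlt => /predU1P[<-|u0]; first by rewrite oppr0 expR0 expr0n add0r.
  have sinh (v : R) : 0 < v -> v *+ 2 <= expR v - expR (- v).
    move=> v0.
    have d (y : R) : is_derive y (1 : R) (fun y => expR y - expR (- y)) (expR y + expR (- y)).
      by apply: is_derive_eq; rewrite /GRing.scale/=; ring.
    have [|w _] := @MVT R (fun y => expR y - expR (- y)) (fun y => expR y + expR (- y)) 0 v v0 (fun y _ => d y).
      apply: derivable_within_continuous => y _; exact: (@ex_derive _ _ _ _ _ _ _ (d y)).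
    rewrite oppr0 subrr !subr0 => ->; rewrite addr0 -mulr_natl; apply: ler_wpM2r; first exact: ltW.
    have wN : expR w * expR (- w) = 1 := expRxMexpNx_1 w.
    rewrite -subr_ge0 (_ : _ - _ = expR (- w) * (expR w - 1) ^+ 2).
      by rewrite mulr_ge0 ?expR_ge0 ?sqr_ge0.
    transitivity (expR w * (expR w * expR (- w)) - 2 * (expR w * expR (- w)) + expR (- w)).
      by rewrite wN; ring.
    by ring.
  have d (y : R) : is_derive y (1 : R) (fun y => expR y + expR (- y) - y ^+ 2) (expR y - expR (- y) - y *+ 2).
    apply: is_derive_eq; rewrite /GRing.scale/=; ring.
  have [|w w0] := @MVT R (fun y => expR y + expR (- y) - y ^+ 2)
      (fun y => expR y - expR (- y) - y *+ 2) 0 u u0 (fun y _ => d y).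
    apply: derivable_within_continuous => y _; exact: (@ex_derive _ _ _ _ _ _ _ (d y)).
  rewrite oppr0 expR0 expr0n addr0 !subr0 => e.
  have : 0 <= (expR w - expR (- w) - w *+ 2) * u.
    apply: mulr_ge0; last exact: ltW.
    by rewrite subr_ge0 sinh//; move: w0; rewrite in_itv/= => /andP[].
  by rewrite -e; lra.
move=> x0.
have -> : x + x^-1 = expR (ln x) + expR (- ln x) by rewrite expRN lnK.
have [l0|l0] := leP 0 (ln x); first exact: pos.
have := pos (- ln x); rewrite sqrrN opprK oppr_ge0 [X in _ -> _ <= X]addrC.
by apply; exact: ltW.
Qed.

(** Put M = n + 1. By [ln_sqr_le] at x / M, the integrand is at most x / M + M / x - 2, and under
    the Gamma law of shape M + 1 the first two terms have means 1 + 1 / M and 1. *)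
Let Q_lnN n : (Q n.+1 (ln n.+1%:R) <= (n.+1%:R^-1)%:E)%E.
Proof.
pose M : R := n.+1%:R.
have M0 : 0 < M by rewrite ltr0n.
(* Up to constants, multiplying the density by x raises the shape by one and dividing by x lowers
   it. *)
have e (x : R) : 0 < x -> (x / M + M / x) * gamma_pdf n.+1 x =
    (1 + M^-1) * gamma_pdf n.+2 x + gamma_pdf n x.
  move=> x0.
  have fn : n`!%:R != 0 :> R by rewrite pnatr_eq0 -lt0n fact_gt0.
  rewrite /gamma_pdf !factS !natrM !exprS.
  have -> : n.+2%:R = M + 1 :> R by rewrite natr1.
  have M1 : M + 1 != 0 by rewrite gt_eqF// addr_gt0.
  rewrite -/M; move: fn; set F := n`!%:R; clearbody F; clearbody M => fn.
  by field; rewrite fn M1 !gt_eqF.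
have k0 : 0 <= 1 + M^-1 by rewrite addr_ge0// invr_ge0 ltW.
have g0 m (x : R) : `]0%R, +oo[%classic x -> (0 <= (gamma_pdf m x)%:E)%E.
  by move=> x0; rewrite lee_fin gamma_pdf0// inE.
have kg0 m (x : R) : `]0%R, +oo[%classic x -> (0 <= (1 + M^-1)%:E * (gamma_pdf m x)%:E)%E.
  by move=> x0; rewrite mule_ge0 ?g0// lee_fin.
have mg m := @measurable_gamma_pdfE m `]0%R, +oo[%classic.
have mkg m : measurable_fun (`]0%R, +oo[%classic : set R)
    (fun x => (1 + M^-1)%:E * (gamma_pdf m x)%:E)%E.
  exact: emeasurable_funM.
(* The 2 stays on the left, so that both sides are integrals of nonnegative functions. *)
have h : (2%:E + Q n.+1 (ln M) <= (1 + M^-1)%:E + 1)%E.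
  have -> : ((1 + M^-1)%:E + 1 = \int[mu]_(x in `]0%R, +oo[)
      ((1 + M^-1)%:E * (gamma_pdf n.+2 x)%:E + (gamma_pdf n x)%:E))%E.
    rewrite ge0_integralD//; [|exact: kg0|exact: mkg|exact: g0|exact: mg].
    by rewrite ge0_integralZl ?lee_fin// ?integral_gamma_pdf ?mule1//; first [exact: g0|exact: mg].
  rewrite -[Q _ _]mul1e -affine_Q//.
  apply: ge0_le_integral => //.
  - by move=> x x0; rewrite mule_ge0 ?g0// lee_fin mul1r addr_ge0 ?sqr_ge0.
  - by apply: measurable_mul_gamma; exact: measurable_affine_lnsq.
  - apply: emeasurable_funD; [exact: mkg|exact: mg].
  - move=> x x0; have xpos : 0 < x by move: x0; rewrite /= in_itv/= andbT.
    rewrite -!EFinM -EFinD lee_fin -e// ler_wpM2r ?gamma_pdf0 ?inE//.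
    by rewrite mul1r addrC -ln_div ?posrE// -[M / x]invf_div ln_sqr_le// divr_gt0.
move: h; rewrite -EFinD -[(1 + M^-1 + 1)]addrAC -natr1 mulr1n [(1 + 1 + M^-1)%:E]EFinD.
by rewrite leeD2lE.
Qed.

(** The weight brings the factor of [x ^+ 2] close to 1; the large factor of [y ^+ 2] is harmless
    because that term will be the vanishing quantity of [Q_lnN]. *)
Let sqr_le_weighted (x y dlt : R) : 0 < dlt ->
  (x + y) ^+ 2 <= (1 + dlt) * x ^+ 2 + (1 + dlt^-1) * y ^+ 2.
Proof.
move=> d0; rewrite -subr_ge0.
rewrite (_ : _ - _ = dlt * (x - y / dlt) ^+ 2); last by field; rewrite gt_eqF.
by rewrite mulr_ge0 ?sqr_ge0// ltW.
Qed.

Let Q_upper (e dlt : R) n : 0 < dlt ->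
  (Q n.+1 (ln n.+1%:R + e) <= ((1 + dlt) * e ^+ 2 + (1 + dlt^-1) * n.+1%:R^-1)%:E)%E.
Proof.
move=> d0; have d1 : 0 <= 1 + dlt^-1 by rewrite addr_ge0// invr_ge0 ltW.
have d2 : 0 <= (1 + dlt) * e ^+ 2 by rewrite mulr_ge0 ?sqr_ge0// addr_ge0// ltW.
apply: (@le_trans _ _ (((1 + dlt) * e ^+ 2)%:E + (1 + dlt^-1)%:E * Q n.+1 (ln n.+1%:R))%E); last first.
  by rewrite [X in (_ <= X)%E]EFinD leeD2l// [X in (_ <= X)%E]EFinM lee_wpmul2l ?lee_fin// Q_lnN.
rewrite -affine_Q//.
apply: ge0_le_integral => //.
- by move=> x x0; exact: lnsq_gamma0.
- by apply: measurable_mul_gamma; exact: measurable_lnsqR.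
- by apply: measurable_mul_gamma; exact: measurable_affine_lnsq.
- move=> x x0; rewrite -!EFinM lee_fin ler_wpM2r ?gamma_pdf0 ?inE//.
  have := sqr_le_weighted (- e) (ln x - ln n.+1%:R) d0.
  by rewrite sqrrN; apply: le_trans; rewrite le_eqVlt; apply/orP; left; apply/eqP; ring.
Qed.

(** The constant [e] is the difference of ln x - ln M and ln x - (ln M + e), with M = n + 1; the
    weighted inequality is integrated against the Gamma density, of mass 1. *)
Let Q_lower (e dlt : R) n : 0 < dlt ->
  ((e ^+ 2)%:E <= (1 + dlt)%:E * Q n.+1 (ln n.+1%:R + e) + ((1 + dlt^-1) * n.+1%:R^-1)%:E)%E.
Proof.
move=> d0; have d1 : 0 <= 1 + dlt^-1 by rewrite addr_ge0// invr_ge0 ltW.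
have d2 : 0 <= 1 + dlt by rewrite addr_ge0// ltW.
apply: (@le_trans _ _ ((1 + dlt)%:E * Q n.+1 (ln n.+1%:R + e) +
    (1 + dlt^-1)%:E * Q n.+1 (ln n.+1%:R))%E); last first.
  by rewrite leeD2l// [X in (_ <= X)%E]EFinM lee_wpmul2l ?lee_fin// Q_lnN.
have mlg k a : measurable_fun (`]0%R, +oo[%classic : set R)
    (fun x => k%:E * (((ln x - a) ^+ 2)%:E * (gamma_pdf n.+1 x)%:E))%E.
  by apply: emeasurable_funM => //; apply: measurable_mul_gamma; exact: measurable_lnsqR.
have klg0 k a (x : R) : 0 <= k -> `]0%R, +oo[%classic x ->
    (0 <= k%:E * (((ln x - a) ^+ 2)%:E * (gamma_pdf n.+1 x)%:E))%E.
  by move=> k0 x0; apply: mule_ge0; [rewrite lee_fin|exact: lnsq_gamma0].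
have kQ k a : 0 <= k -> (k%:E * Q n.+1 a =
    \int[mu]_(x in `]0%R, +oo[) (k%:E * (((ln x - a) ^+ 2)%:E * (gamma_pdf n.+1 x)%:E)))%E.
  move=> k0; rewrite ge0_integralZl ?lee_fin//.
    by apply: measurable_mul_gamma; exact: measurable_lnsqR.
  by move=> x x0; exact: lnsq_gamma0.
have -> : ((e ^+ 2)%:E = \int[mu]_(x in `]0%R, +oo[) ((e ^+ 2)%:E * (gamma_pdf n.+1 x)%:E))%E.
  rewrite ge0_integralZl ?lee_fin ?sqr_ge0 ?integral_gamma_pdf ?mule1//.
    exact: measurable_gamma_pdfE.
  by move=> x x0; rewrite lee_fin gamma_pdf0// inE.
rewrite !kQ// -ge0_integralD//;
  [|by move=> x x0; exact: klg0|exact: mlg|by move=> x x0; exact: klg0|exact: mlg].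
apply: ge0_le_integral => //.
- by move=> x x0; rewrite mule_ge0 ?lee_fin ?sqr_ge0// gamma_pdf0// inE.
- exact: (measurable_mul_gamma n.+1 (f := cst (e ^+ 2))).
- by apply: emeasurable_funD; exact: mlg.
- move=> x x0; rewrite !muleA -!EFinM -EFinD -mulrDl lee_fin ler_wpM2r ?gamma_pdf0 ?inE//.
  have := sqr_le_weighted (- (ln x - (ln n.+1%:R + e))) (ln x - ln n.+1%:R) d0.
  by rewrite sqrrN; apply: le_trans; rewrite le_eqVlt; apply/orP; left; apply/eqP; ring.
Qed.

(** Iterating the recursion recentres the second moment at ln M + [e N] with M = n + N + 1. There ln
    G is close to ln M, so the moment tends to the square of the limit of [e N], while the sums of 1
    / k^2 accumulate to the Basel tail. *)
Lemma integral_ln_gamma n a :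
  (\int[mu]_(x in `]0%R, +oo[) (((ln x - a) ^+ 2)%:E * (gamma_pdf n x)%:E) =
   (pi ^+ 2 / 6 - \sum_(1 <= k < n.+1) k%:R ^- 2 +
    (harm n - euler_gamma R - a) ^+ 2)%:E)%E.
Proof.
rewrite -/(Q n a) -/(Z n).
pose e (N : nat) : R := a + (harm (n + N.+1) - ln (n + N.+1)%:R) - harm n.
have eN N : a + harm (n + N.+1) - harm n = ln (n + N.+1)%:R + e N by rewrite /e; ring.
have Q0 : (0 <= Q n a)%E by apply: integral_ge0 => x x0; exact: lnsq_gamma0.
have cvgn1 (u : nat -> R) (l : R) : (u k @[k --> \oo] --> l) ->
    (u (n + k.+1)%N @[k --> \oo] --> l).
  move=> ul; have -> : (fun k => u (n + k.+1)%N) = (fun k => u (k + n.+1)%N).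
    by apply/funext => k; rewrite addnS -addSn addnC.
  by rewrite (cvg_shiftn n.+1 u).
have ce : e N @[N --> \oo] --> a + euler_gamma R - harm n.
  apply: cvgB; last exact: cvg_cst.
  apply: cvgD; first exact: cvg_cst.
  exact: (cvgn1 (fun k : nat => harm k - ln (k%:R : R)) _ cvg_euler_gamma).
have cz : Z (n + N.+1)%N - Z n @[N --> \oo] --> pi ^+ 2 / 6 - Z n.
  apply: cvgB; last exact: cvg_cst.
  exact: (cvgn1 Z _ (@cvg_sum_invsqr R)).
have ci : (n + N.+1)%:R^-1 @[N --> \oo] --> (0 : R).
  apply: (cvgn1 (fun k => (k%:R : R)^-1)); rewrite -cvg_shiftS; exact: cvg_harmonic.
have QE N : Q n a = ((Z (n + N.+1) - Z n)%:E + Q (n + N).+1 (ln (n + N.+1)%:R + e N))%E.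
  by rewrite (Q_iter n N.+1) eN addnS.
(* A single upper bound, at N = 0 and weight 1, gives finiteness and moves the rest of the argument
   to real numbers. *)
have Qfin : Q n a \is a fin_num.
  rewrite ge0_fin_numE// (QE 0%N) addnS.
  apply: (le_lt_trans (leeD2l _ (Q_upper (e 0%N) _ (@ltr01 R)))).
  by rewrite -EFinD ltry.
move: Qfin QE => /fineK; set q := fine _ => qE QE.
(* The limit of the recentred moments in [QN]; it remains to squeeze it against [E ^+ 2]. *)
pose l := q - (pi ^+ 2 / 6 - Z n).
have QN N : Q (n + N.+1) (ln (n + N.+1)%:R + e N) = (q - (Z (n + N.+1) - Z n))%:E.
  have := QE N; rewrite -qE -addnS; case: (Q _ _) => [r| |]//= [->].
  by congr (_%:E); ring.
have cq : q - (Z (n + N.+1)%N - Z n) @[N --> \oo] --> l by apply: cvgB => //; exact: cvg_cst.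
set E := a + euler_gamma R - harm n in ce *.
have up dlt : 0 < dlt -> l <= (1 + dlt) * E ^+ 2.
  move=> d0.
  have : (1 + dlt) * e N ^+ 2 + (1 + dlt^-1) * (n + N.+1)%:R^-1 @[N --> \oo] -->
      (1 + dlt) * E ^+ 2 + (1 + dlt^-1) * 0.
    apply: cvgD; apply: cvgM; [exact: cvg_cst| |exact: cvg_cst|exact: ci].
    by rewrite expr2; under eq_fun do rewrite expr2; exact: cvgM.
  rewrite mulr0 addr0 => cv; apply: (ler_cvg_to cq cv); apply: nearW => N /=.
  have := Q_upper (e N) (n + N) d0; rewrite -addnS QN lee_fin; exact.
have lo dlt : 0 < dlt -> E ^+ 2 <= (1 + dlt) * l.
  move=> d0.
  have : (1 + dlt) * (q - (Z (n + N.+1) - Z n)) + (1 + dlt^-1) * (n + N.+1)%:R^-1 @[N --> \oo] -->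
      (1 + dlt) * l + (1 + dlt^-1) * 0.
    by apply: cvgD; apply: cvgM => //; exact: cvg_cst.
  rewrite mulr0 addr0 => cv.
  have ce2 : e N ^+ 2 @[N --> \oo] --> E ^+ 2.
    by rewrite expr2; under eq_fun do rewrite expr2; exact: cvgM.
  apply: (ler_cvg_to ce2 cv); apply: nearW => N /=.
  have := Q_lower (e N) (n + N) d0; rewrite -addnS QN -EFinM -EFinD lee_fin; exact.
have E0 := sqr_ge0 E.
have l0 : 0 <= l by have := lo 1 ltr01; lra.
have lE : l = E ^+ 2.
  apply/eqP; rewrite eq_le; apply/andP; split; apply/ler_addgt0Pr => eps eps0.
    (* This weight keeps dlt * E^2 below eps; adding 1 to the denominator covers E = 0. *)
    apply: le_trans (up (eps / (E ^+ 2 + 1)) _) _; first by rewrite divr_gt0// ltr_pwDr.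
    rewrite mulrDl mul1r lerD2l mulrAC ler_pdivrMr ?ltr_pwDr// ler_pM2l//.
    by rewrite lerDl.
  apply: le_trans (lo (eps / (l + 1)) _) _; first by rewrite divr_gt0// ltr_pwDr.
  rewrite mulrDl mul1r lerD2l mulrAC ler_pdivrMr ?ltr_pwDr// ler_pM2l//.
  by rewrite lerDl.
rewrite -qE; congr (_%:E).
have -> : q = pi ^+ 2 / 6 - Z n + l by rewrite /l addrC subrK.
by rewrite lE /E; congr (_ + _); rewrite -sqrrN; congr (_ ^+ 2); ring.
Qed.

(** [k] will be the variance contributed by the smaller determinant. *)
Lemma integral_ln_gammaD n k a : 0 <= k ->
  (\int[mu]_(x in `]0%R, +oo[) ((k + (ln x - a) ^+ 2)%:E * (gamma_pdf n x)%:E) =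
   (k + (pi ^+ 2 / 6 - \sum_(1 <= k < n.+1) k%:R ^- 2) +
    (harm n - euler_gamma R - a) ^+ 2)%:E)%E.
Proof.
move=> k0; rewrite -addrA EFinD -integral_ln_gamma -[X in (_ + X)%E]mul1e -affine_Q//.
by apply: eq_integral => x _; rewrite mul1r.
Qed.

End gamma_log_moments.

(** * Unitary reduction of complex Gaussian matrices *)

Section conjugate_transpose.
Context {R : rcfType}.
Local Notation C := R[i].

Lemma ctrmx_mul m n p (A : 'M[C]_(m, n)) (B : 'M[C]_(n, p)) :
  ctrmx (A *m B) = ctrmx B *m ctrmx A.
Proof.
apply/matrixP => i j; rewrite !mxE rmorph_sum; apply: eq_bigr => k _.
by rewrite !mxE rmorphM mulrC.
Qed.

Lemma ctrmx_block m1 m2 n1 n2 (A : 'M[C]_(m1, n1)) (B : 'M[C]_(m1, n2))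
    (D : 'M[C]_(m2, n1)) (E : 'M[C]_(m2, n2)) :
  ctrmx (block_mx A B D E) = block_mx (ctrmx A) (ctrmx D) (ctrmx B) (ctrmx E).
Proof.
have e m n (M : 'M[C]_(m, n)) : ctrmx M = map_mx Num.conj (M^T).
  by apply/matrixP => i j; rewrite !mxE.
by rewrite !e tr_block_mx map_block_mx.
Qed.

Lemma det_gram_block m n (x : C) (B : 'M[C]_(1, n)) (D : 'M[C]_(m, n)) :
  let A := block_mx (x%:M : 'M[C]_1) B 0 D in
  \det (ctrmx A *m A) = Num.conj x * x * \det (ctrmx D *m D).
Proof.
move=> A.
have cx : ctrmx (x%:M : 'M[C]_1) = (Num.conj x)%:M.
  by apply/matrixP => i j; rewrite !mxE !ord1/=.
have c0 : ctrmx (0 : 'M[C]_(m, 1)) = 0.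
  by apply/matrixP => i j; rewrite !mxE rmorph0.
(* A triangular factorization free of division, so that x = 0 is covered. *)
have -> : ctrmx A *m A = block_mx (Num.conj x)%:M 0 (ctrmx B) 1%:M *m
    (block_mx 1%:M 0 0 (ctrmx D *m D) *m block_mx x%:M B 0 1%:M).
  rewrite ctrmx_block cx c0 !mulmx_block.
  by rewrite !mul0mx !mulmx0 !mul1mx !mulmx1 !addr0 !add0r.
rewrite !det_mulmx !det_ublock !det_lblock !det1 !det_scalar1 !mul1r !mulr1.
by rewrite [_ * x]mulrC mulrA.
Qed.

Lemma gram_unitary m n (U : 'M[C]_m) (A : 'M[C]_(m, n)) :
  ctrmx U *m U = 1%:M -> ctrmx (U *m A) *m (U *m A) = ctrmx A *m A.
Proof. by move=> UU; rewrite ctrmx_mul -mulmxA (mulmxA (ctrmx U)) UU mul1mx. Qed.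

(** The last equation says that the rotation annihilates the second coordinate: - s a + c b = 0. *)
Lemma exists_rotation (a b : R) : exists c s : R, c ^+ 2 + s ^+ 2 = 1 /\ c * b = s * a.
Proof.
have [n0|n0] := eqVneq (a ^+ 2 + b ^+ 2) 0.
  exists 1, 0; rewrite expr1n expr0n addr0 mul1r mul0r; split => //.
  by move/eqP: n0; rewrite paddr_eq0 ?sqr_ge0// sqrf_eq0 => /andP[_]; rewrite sqrf_eq0 => /eqP.
pose n := Num.sqrt (a ^+ 2 + b ^+ 2).
have nn : n ^+ 2 = a ^+ 2 + b ^+ 2 by rewrite sqr_sqrtr// addr_ge0 ?sqr_ge0.
exists (a / n), (b / n); split; last by rewrite mulrAC [a * b]mulrC mulrAC.
by rewrite !expr_div_n -mulrDl -nn divff// nn.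
Qed.

Definition givens n (k l : 'I_n) (c s : R) : 'M[C]_n := \matrix_(i, j)
  if i == k then c%:C%C * (j == k)%:R + s%:C%C * (j == l)%:R
  else if i == l then - s%:C%C * (j == k)%:R + c%:C%C * (j == l)%:R
  else (i == j)%:R.

Definition phase n (k : 'I_n) (z : C) : 'M[C]_n := \matrix_(i, j)
  if i == k then z * (i == j)%:R else (i == j)%:R.

Lemma sum_delta n (k : 'I_n) (v : 'I_n -> C) : \sum_i (i == k)%:R * v i = v k.
Proof.
rewrite (bigD1 k)//= eqxx mul1r big1 ?addr0// => i /negbTE ->.
by rewrite mul0r.
Qed.

Lemma givensE n (k l : 'I_n) c s (v : 'I_n -> C) i :
  \sum_j givens k l c s i j * v j =
  if i == k then c%:C%C * v k + s%:C%C * v l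
  else if i == l then - s%:C%C * v k + c%:C%C * v l else v i.
Proof.
under eq_bigr do rewrite mxE.
have e (a b : C) : \sum_j (a * (j == k)%:R + b * (j == l)%:R) * v j = a * v k + b * v l.
  under eq_bigr do rewrite mulrDl -!mulrA.
  by rewrite big_split/= -!mulr_sumr !sum_delta.
case: (i == k); first exact: e.
case: (i == l); first exact: e.
by under eq_bigr do rewrite eq_sym; rewrite sum_delta.
Qed.

Lemma phaseE n (k : 'I_n) z (v : 'I_n -> C) i :
  \sum_j phase k z i j * v j = if i == k then z * v k else v i.
Proof.
under eq_bigr do rewrite mxE.
case: eqP => [->|_].
  by under eq_bigr do rewrite eq_sym -mulrA; rewrite -mulr_sumr sum_delta.
by under eq_bigr do rewrite eq_sym; rewrite sum_delta.
Qed.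

Lemma givens_unitary n (k l : 'I_n) c s : k != l -> c ^+ 2 + s ^+ 2 = 1 ->
  ctrmx (givens k l c s) *m givens k l c s = 1%:M.
Proof.
move=> kl cs.
have lk : (l == k) = false by rewrite eq_sym; exact/negbTE.
have conjR (x : R) : Num.conj (x%:C%C : C) = x%:C%C by exact: conjc_real.
have conjN (b : bool) : Num.conj (b%:R : C) = b%:R by rewrite conjC_nat.
have -> : ctrmx (givens k l c s) = givens k l c (- s).
  apply/matrixP => i j; rewrite !mxE.
  have [->|jk] := eqVneq j k; have [->|ik] := eqVneq i k;
    rewrite ?rmorphD ?rmorphM ?rmorphN /= ?conjR ?conjN ?eqxx ?lk ?(negbTE kl) ?mulr0 ?mulr1 ?addr0 ?add0r.
  - by [].
  - by case: (i == l); rewrite ?mulr1 ?mulr0 ?opprK.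
  - by rewrite (negbTE jk); case: (j == l); rewrite ?rmorphN /= ?conjR ?conjC0 ?mulr1 ?mulr0.
  - have [jl|jl] := eqVneq j l; have [il|il] := eqVneq i l;
      rewrite ?jl ?il ?eqxx ?(negbTE il) ?(negbTE jl) ?rmorphM /= ?conjR ?conjN ?mulr0 ?mulr1 ?rmorph0//.
    by rewrite eq_sym.
have CS : c%:C%C ^+ 2 + s%:C%C ^+ 2 = 1 :> C by rewrite -!rmorphXn -rmorphD cs rmorph1.
apply/matrixP => i j; rewrite mxE givensE !mxE !eqxx lk !rmorphN /=.
have [->|ik] := eqVneq i k.
  rewrite [k == j]eq_sym; transitivity ((c%:C%C ^+ 2 + s%:C%C ^+ 2) * (j == k)%:R : C); first by ring.
  by rewrite CS mul1r.
have [->|//] := eqVneq i l.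
rewrite [l == j]eq_sym; transitivity ((c%:C%C ^+ 2 + s%:C%C ^+ 2) * (j == l)%:R : C); first by ring.
by rewrite CS mul1r.
Qed.

Lemma phase_unitary n (k : 'I_n) z : Num.conj z * z = 1 ->
  ctrmx (phase k z) *m phase k z = 1%:M.
Proof.
move=> zz.
have conjN (b : bool) : Num.conj (b%:R : C) = b%:R by rewrite conjC_nat.
have -> : ctrmx (phase k z) = phase k (Num.conj z).
  apply/matrixP => i j; rewrite !mxE.
  have [->|ij] := eqVneq i j; last by rewrite !mulr0 !if_same rmorph0.
  by rewrite !mulr1; case: ifP => _ //; rewrite rmorph1.
apply/matrixP => i j; rewrite mxE phaseE !mxE eqxx.
by have [->|//] := eqVneq i k; rewrite mulrA zz mul1r.
Qed.

End conjugate_transpose.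

Section isotropy.
Context {R : realType} d (T : measurableType d) (P : probability T R).
Local Notation C := R[i].

Definition entry_part (b : bool) (z : C) : R := if b then complex.Im z else complex.Re z.

(** The product of [U] with the complex array [X], returned as a real family over the same indices
    so that [gaussian_on] applies to it. [J] indexes the columns. *)
Definition left_action r (J : finType) (U : 'M[C]_r) (X : 'I_r * J * bool -> T -> R)
    (k : 'I_r * J * bool) (w : T) : R :=
  entry_part k.2 (\sum_i U k.1.1 i * (X (i, k.1.2, false) w +i* X (i, k.1.2, true) w)%C).

(* Unitary matrices whose left action provably preserves i.i.d. Gaussian
   arrays; generating them by plane rotations avoids a change of variables in
   higher dimension. *)
Definition isotropic r (U : 'M[C]_r) : Prop :=
  ctrmx U *m U = 1%:M /\
  forall (J : finType) (X : 'I_r * J * bool -> T -> R),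
    gaussian_on P predT X -> gaussian_on P predT (left_action U X).

Lemma isotropic1 r : isotropic (1%:M : 'M[C]_r).
Proof.
split=> [|J X].
  by rewrite mulmx1; apply/matrixP => i j; rewrite !mxE eq_sym conjC_nat.
apply: eq_gaussian_on => -[[i j] b] _ w; rewrite /left_action/=.
under eq_bigr do rewrite mxE eq_sym.
by rewrite sum_delta; case: b.
Qed.

Lemma isotropic_mul r (U V : 'M[C]_r) : isotropic U -> isotropic V -> isotropic (U *m V).
Proof.
move=> [UU gU] [VV gV]; split=> [|J X gX].
  by rewrite ctrmx_mul -mulmxA (mulmxA (ctrmx U)) UU mul1mx.
apply: eq_gaussian_on (gU _ _ (gV _ _ gX)) => -[[i j] b] _ w.
rewrite /left_action/=; congr (entry_part b _).
under [RHS]eq_bigr do rewrite mxE mulr_suml.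
rewrite exchange_big/=; apply: eq_bigr => k _.
under [RHS]eq_bigr do rewrite -mulrA.
rewrite -mulr_sumr; congr (_ * _).
by case: (\sum_i _).
Qed.

(** The coefficients are real, so real and imaginary parts rotate separately: the pairs are indexed
    by a column and a part. *)
Lemma isotropic_givens r (k l : 'I_r) (c s : R) : k != l -> c ^+ 2 + s ^+ 2 = 1 ->
  isotropic (givens k l c s).
Proof.
move=> kl cs; split=> [|J X gX]; first exact: givens_unitary.
have lk : (l == k) = false by rewrite eq_sym; exact/negbTE.
apply: (gaussian_rotate_pairs (J := (J * bool)%type) (k := fun j => (k, j.1, j.2))
  (l := fun j => (l, j.1, j.2)) _ _ _ cs gX).
- by move=> [j b] [j' b'] [-> ->].
- by move=> [j b] [j' b'] [-> ->].
- by move=> [j b] [j' b']; rewrite !xpair_eqE (negbTE kl).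
- move=> [j b] w; rewrite /left_action/= givensE eqxx.
  by case: b; rewrite /entry_part /=; ring.
- move=> [j b] w; rewrite /left_action/= givensE eqxx lk.
  by case: b; rewrite /entry_part /=; ring.
- move=> [[i j] b] ik il w; rewrite /left_action/= givensE.
  have /negbTE -> : i != k by apply: contraNneq ik => ->; apply/codomP; exists (j, b).
  have /negbTE -> : i != l by apply: contraNneq il => ->; apply/codomP; exists (j, b).
  by case: b {ik il}.
Qed.

Lemma isotropic_phase r (k : 'I_r) (c s : R) : c ^+ 2 + s ^+ 2 = 1 ->
  isotropic (phase k (c +i* s)%C).
Proof.
move=> cs; split=> [|J X gX].
  apply: phase_unitary; apply/eqP; rewrite eq_complex/=; apply/andP; split; apply/eqP.
    by rewrite -cs; ring.
  by ring.
(* Multiplication by c + i s sends (re, im) to (c re - s im, s re + c im), a plane rotation in the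
   present convention with - s in place of s. *)
have cs' : c ^+ 2 + (- s) ^+ 2 = 1 by rewrite sqrrN.
apply: (gaussian_rotate_pairs (k := fun j : J => (k, j, false))
  (l := fun j => (k, j, true)) _ _ _ cs' gX).
- by move=> j j' [->].
- by move=> j j' [->].
- by move=> j j'; rewrite !xpair_eqE andbF.
- by move=> j w; rewrite /left_action/= phaseE eqxx /entry_part /=; ring.
- by move=> j w; rewrite /left_action/= phaseE eqxx /entry_part /=; ring.
- move=> [[i j] b] ik il w; rewrite /left_action/= phaseE.
  have /negbTE -> : i != k.
    apply: contraTneq isT => ik'; case: b ik il => ik il.
      by case/codomP: il; exists j; rewrite ik'.
    by case/codomP: ik; exists j; rewrite ik'.
  by case: b {ik il}.
Qed.

Lemma isotropic_real r (y : 'cV[C]_r) (n : nat) : exists2 U, isotropic U &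
  forall i : 'I_r, (i < n)%N -> complex.Im ((U *m y) i 0) = 0.
Proof.
elim: n => [|n [U iU Uy]]; first by exists 1%:M => //; exact: isotropic1.
have [rn|nr] := leqP r n.
  by exists U => // i _; apply: Uy; exact: leq_trans rn.
pose k := Ordinal nr.
have [c [s [cs cbsa]]] := exists_rotation (complex.Re ((U *m y) k 0)) (complex.Im ((U *m y) k 0)).
have cs' : c ^+ 2 + (- s) ^+ 2 = 1 by rewrite sqrrN.
(* The pair (c, s) is the direction of the entry; the conjugate phase turns it onto the real
   axis. *)
exists (phase k (c +i* (- s))%C *m U).
  by apply: isotropic_mul => //; exact: isotropic_phase.
move=> i; rewrite ltnS => ilen; rewrite -mulmxA mxE phaseE.
have [ik|ik] := eqVneq i k.
  by move: cbsa; case: ((U *m y) k 0) => a b /= e; rewrite e; ring.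
by apply: Uy; rewrite ltn_neqAle ilen andbT; apply: contraNneq ik => e; apply/eqP/val_inj.
Qed.

(** All entries are made real at the start, so a real Givens rotation against entry 0 cancels each
    further entry and keeps the vector real. *)
Lemma isotropic_eliminate r (y : 'cV[C]_r.+1) (n : nat) : exists2 U, isotropic U &
  (forall i, complex.Im ((U *m y) i 0) = 0) /\
  (forall i : 'I_r.+1, (0 < i)%N -> (i <= n)%N -> (U *m y) i 0 = 0).
Proof.
elim: n => [|n [U iU [Ur Uz]]].
  have [U iU Uy] := isotropic_real y r.+1; exists U => //.
  by split=> [i|i i0]; [exact: Uy|rewrite leqNgt i0].
have [rn|nr] := leqP r.+1 n.+1.
  by exists U => //; split => // i i0 _; apply: Uz => //; rewrite -ltnS (leq_trans (ltn_ord i)).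
pose k : 'I_r.+1 := Ordinal nr.
have k0 : ord0 != k by [].
have [c [s [cs cbsa]]] := exists_rotation (complex.Re ((U *m y) ord0 0)) (complex.Re ((U *m y) k 0)).
exists (givens ord0 k c s *m U).
  by apply: isotropic_mul => //; exact: isotropic_givens.
have re i : (U *m y) i 0 = (complex.Re ((U *m y) i 0))%:C%C.
  by apply/eqP; rewrite eq_complex/= Ur !eqxx.
split=> [i|i i0 ilen]; rewrite -mulmxA mxE givensE.
  rewrite (re ord0) (re k).
  by case: (i == ord0) => /=; [ring|case: (i == k) => //=; ring].
rewrite ifF; last by apply/negbTE; rewrite -(inj_eq val_inj) -lt0n.
have [ik|ik] := eqVneq i k.
  rewrite (re ord0) (re k) -rmorphN -!rmorphM -rmorphD /= mulNr cbsa addNr//.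
apply: Uz => //; rewrite -ltnS ltn_neqAle ilen andbT; apply: contraNneq ik => e.
by apply/eqP/val_inj.
Qed.

Definition sqnorm r (y : 'cV[C]_r) : R :=
  \sum_i (complex.Re (y i 0) ^+ 2 + complex.Im (y i 0) ^+ 2).

Lemma sqnormE r (y : 'cV[C]_r) : (ctrmx y *m y) 0 0 = (sqnorm y)%:C%C.
Proof.
rewrite mxE /sqnorm rmorph_sum; apply: eq_bigr => i _; rewrite mxE.
case: (y i 0) => a b; apply/eqP; rewrite eq_complex/=; apply/andP; split; apply/eqP; ring.
Qed.

(** The norm is preserved by unitarity. The sign of [x] is left open, since the determinant will
    involve only its square. *)
Lemma isotropic_to_axis r (y : 'cV[C]_r.+1) : exists2 U, isotropic U &
  exists2 x : R, x ^+ 2 = sqnorm y & U *m y = col_mx (x%:C%C%:M : 'M[C]_1) (0 : 'cV[C]_r).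
Proof.
have [U iU [Ur Uz]] := isotropic_eliminate y r.
exists U => //; exists (complex.Re ((U *m y) ord0 0)).
  apply: (@complexI R); rewrite -sqnormE -(gram_unitary y iU.1) sqnormE.
  congr (_%:C)%C; rewrite /sqnorm big_ord_recl/= Ur expr0n addr0 big1 ?addr0// => i _.
  by rewrite Uz//= expr0n addr0.
apply/matrixP => i j; rewrite !ord1.
have [i0|i0] := posnP i.
  have -> : i = lshift r (ord0 : 'I_1) by apply: val_inj.
  apply: (eq_trans _ (esym (col_mxEu _ _ _ _))); rewrite [RHS]mxE eqxx mulr1n.
  have -> : lshift r (ord0 : 'I_1) = ord0 :> 'I_r.+1 by apply: val_inj.
  by apply/eqP; rewrite eq_complex/= Ur !eqxx.
have ir : (i.-1 < r)%N by rewrite prednK// -ltnS; exact: ltn_ord.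
have -> : i = rshift 1 (Ordinal ir) by apply: val_inj; rewrite /= add1n prednK.
apply: (eq_trans _ (esym (col_mxEd _ _ _ _))).
by rewrite [RHS]mxE Uz//= add1n.
Qed.

End isotropy.

Section complex_measurability.
Context {R : realType} d (T : measurableType d).
Local Notation C := R[i].

Definition cmeasurable (f : T -> C) :=
  measurable_fun setT (fun w => complex.Re (f w)) /\
  measurable_fun setT (fun w => complex.Im (f w)).

Lemma cmeasurable_cst z : cmeasurable (cst z).
Proof. by split; exact: measurable_cst. Qed.

Lemma cmeasurableD f g : cmeasurable f -> cmeasurable g -> cmeasurable (fun w => f w + g w).
Proof.
move=> [f1 f2] [g1 g2]; split.
  rewrite (_ : (fun w => _) = (fun w => complex.Re (f w) + complex.Re (g w))).
    exact: measurable_funD.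
  by apply/funext => w; case: (f w); case: (g w).
rewrite (_ : (fun w => _) = (fun w => complex.Im (f w) + complex.Im (g w))).
  exact: measurable_funD.
by apply/funext => w; case: (f w); case: (g w).
Qed.

Lemma cmeasurableM f g : cmeasurable f -> cmeasurable g -> cmeasurable (fun w => f w * g w).
Proof.
move=> [f1 f2] [g1 g2]; split.
  rewrite (_ : (fun w => _) = (fun w => complex.Re (f w) * complex.Re (g w)
                                       - complex.Im (f w) * complex.Im (g w))).
    by apply: measurable_funB; exact: measurable_funM.
  by apply/funext => w; case: (f w); case: (g w).
rewrite (_ : (fun w => _) = (fun w => complex.Re (f w) * complex.Im (g w)
                                     + complex.Im (f w) * complex.Re (g w))).
  by apply: measurable_funD; exact: measurable_funM.
by apply/funext => w; case: (f w); case: (g w).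
Qed.

Lemma cmeasurable_conj f : cmeasurable f -> cmeasurable (fun w => Num.conj (f w)).
Proof.
move=> [f1 f2]; split.
  rewrite (_ : (fun w => _) = (fun w => complex.Re (f w)))//.
  by apply/funext => w; case: (f w).
rewrite (_ : (fun w => _) = (fun w => - complex.Im (f w))).
  exact: measurableT_comp.
by apply/funext => w; case: (f w).
Qed.

Lemma cmeasurable_sum I (s : seq I) (f : I -> T -> C) :
  (forall i, cmeasurable (f i)) -> cmeasurable (fun w => \sum_(i <- s) f i w).
Proof.
move=> mf; elim: s => [|i s IH].
  by under eq_fun do rewrite big_nil; exact: cmeasurable_cst.
by under eq_fun do rewrite big_cons; exact: cmeasurableD.
Qed.

Lemma cmeasurable_prod I (s : seq I) (f : I -> T -> C) :
  (forall i, cmeasurable (f i)) -> cmeasurable (fun w => \prod_(i <- s) f i w).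
Proof.
move=> mf; elim: s => [|i s IH].
  by under eq_fun do rewrite big_nil; exact: cmeasurable_cst.
by under eq_fun do rewrite big_cons; exact: cmeasurableM.
Qed.

Lemma cmeasurable_det n (A : T -> 'M[C]_n) :
  (forall i j, cmeasurable (fun w => A w i j)) -> cmeasurable (fun w => \det (A w)).
Proof.
move=> mA; apply: cmeasurable_sum => s; apply: cmeasurableM; first exact: cmeasurable_cst.
by apply: cmeasurable_prod => i; exact: mA.
Qed.

Definition sqdet r t (A : 'M[C]_(r, t)) : R := complex.Re (\det (ctrmx A *m A)).

Lemma measurable_sqdet r t (A : T -> 'M[C]_(r, t)) :
  (forall i j, cmeasurable (fun w => A w i j)) -> measurable_fun setT (fun w => sqdet (A w)).
Proof.
move=> mA; have [] // := @cmeasurable_det _ (fun w => ctrmx (A w) *m A w) _ => i j.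
under eq_fun do rewrite mxE; apply: cmeasurable_sum => k.
apply: cmeasurableM => //; under eq_fun do rewrite mxE.
exact: cmeasurable_conj.
Qed.

End complex_measurability.

(** * Conditioning on the first column *)

Section determinant_recursion.
Context {R : realType}.
Local Notation C := R[i].
Local Notation mu := (@lebesgue_measure R).

(** The matrix of [cmatrix] with its indices gathered in one finite type, the form in which
    [gaussian_on] treats it. *)
Definition cmx r t (f : 'I_r * 'I_t * bool -> R) : 'M[C]_(r, t) :=
  \matrix_(i, j) (f (i, j, false) +i* f (i, j, true))%C.

Lemma measurable_sqdet_cmx r t :
  measurable_fun setT (fun f : @vectors R ('I_r * 'I_t * bool)%type => sqdet (cmx f)).
Proof.
apply: measurable_sqdet => i j; split.
  apply: eq_measurable_fun (measurable_coordinate (i, j, false)).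
  by move=> f _; rewrite /cmx mxE.
apply: eq_measurable_fun (measurable_coordinate (i, j, true)).
by move=> f _; rewrite /cmx mxE.
Qed.

(** Multiplying by [U] keeps the Gram matrix and makes the matrix block triangular, with [x] in the
    corner. *)
Lemma sqdet_row_mx r t (U : 'M[C]_r.+1) (y : 'cV[C]_r.+1) (x : R) (B : 'M[C]_(r.+1, t)) :
  ctrmx U *m U = 1%:M -> U *m y = col_mx (x%:C%C%:M : 'M[C]_1) (0 : 'cV[C]_r) ->
  sqdet (row_mx y B) = x ^+ 2 * sqdet (dsubmx (U *m B : 'M[C]_(1 + r, t))).
Proof.
move=> UU Uy; rewrite /sqdet -(gram_unitary (row_mx y B) UU) mul_mx_row Uy.
rewrite -[U *m B](@vsubmxK _ 1 r t) -(block_mxEh (x%:C%C%:M : 'M[C]_1)).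
rewrite det_gram_block col_mxKd.
rewrite (_ : Num.conj x%:C%C = x%:C%C); last exact: conjc_real.
rewrite -rmorphM/= -expr2; set z := \det _; case: z => a b /=.
by rewrite mul0r subr0.
Qed.

Local Open Scope ereal_scope.

Lemma cmx_dsubmx r t d (T : measurableType d) (U : 'M[C]_r.+1)
    (X : 'I_r.+1 * 'I_t * bool -> T -> R) w :
  dsubmx (U *m cmx (fun k => X k w) : 'M[C]_(1 + r, t)) =
  cmx (fun k => left_action U X (lift ord0 k.1.1, k.1.2, k.2) w).
Proof.
apply/matrixP => i j; rewrite !mxE rshift1 /left_action/=.
under eq_bigr do rewrite mxE.
by apply/eqP; rewrite eq_complex /entry_part/= !eqxx.
Qed.

Lemma cmx_row_mx r t (f : 'I_r * 'I_t.+1 * bool -> R) :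
  cmx f = row_mx (\col_i (f (i, ord0, false) +i* f (i, ord0, true))%C : 'M[C]_(r, 1))
                 (cmx (fun k => f (k.1.1, lift ord0 k.1.2, k.2)) : 'M[C]_(r, t)).
Proof.
apply/matrixP => i j; rewrite [LHS]mxE.
have [j0|j0] := posnP j.
  have -> : j = lshift t (ord0 : 'I_1) by apply: val_inj.
  apply: (eq_trans _ (esym (row_mxEl _ _ _ _))); rewrite mxE.
  by have -> : lshift t (ord0 : 'I_1) = ord0 :> 'I_t.+1 by apply: val_inj.
have jt : (j.-1 < t)%N by rewrite prednK// -ltnS; exact: ltn_ord.
have -> : j = rshift 1 (Ordinal jt) by apply: val_inj; rewrite /= add1n prednK.
by apply: (eq_trans _ (esym (row_mxEr _ _ _ _))); rewrite mxE/= rshift1.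
Qed.

Lemma gaussian_on_minor r t d (T : measurableType d) (P : probability T R)
    (X : 'I_r.+1 * 'I_t.+1 * bool -> T -> R) :
  gaussian_on P predT X ->
  gaussian_on P predT (fun k : 'I_r * 'I_t * bool => X (lift ord0 k.1.1, lift ord0 k.1.2, k.2)).
Proof.
apply: (gaussian_on_inj (s := fun k : 'I_r * 'I_t * bool => (lift ord0 k.1.1, lift ord0 k.1.2, k.2))) => //.
by move=> [[i j] b] [[i' j'] b'] [] /= e1 e2 ->; congr (_, _, _); apply/ord_inj.
Qed.

Lemma measurable_sqdet_gaussian r t d (T : measurableType d) (P : probability T R)
    (X : 'I_r * 'I_t * bool -> T -> R) :
  gaussian_on P predT X -> measurable_fun setT (fun w => sqdet (cmx (fun k => X k w))).
Proof.
move=> gX; apply: (measurableT_comp (@measurable_sqdet_cmx r t)).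
by apply: measurable_vectorP => i; exact: gX.1.
Qed.

(** The first column and the other columns are taken from two independent copies of [P], and Tonelli
    freezes the former. Any nonnegative [phi] is allowed, so that the same identity serves an
    indicator and a squared logarithm. *)
Lemma ge0_integral_sqdetS r t d (T : measurableType d) (P : probability T R)
    (X : 'I_r.+1 * 'I_t.+1 * bool -> T -> R) (phi : R -> \bar R) :
  gaussian_on P predT X -> measurable_fun setT phi -> (forall s, 0 <= phi s) ->
  \int[P]_w phi (sqdet (cmx (fun k => X k w))) =
  \int[mu]_(x in `]0%R, +oo[) ((\int[P]_w
     phi (x * sqdet (cmx (fun k => X (lift ord0 k.1.1, lift ord0 k.1.2, k.2) w)))%R)
     * (gamma_pdf r x)%:E).
Proof.
move=> gX mphi phi0.
pose p : pred ('I_r.+1 * 'I_t.+1 * bool) := [pred k | k.1.2 == ord0].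
have gp : gaussian_on P p X by apply: gaussian_onS gX.
have gcp : gaussian_on P (predC p) X by apply: gaussian_onS gX.
have gZ := gaussian_on_prod gp gcp.
set Z := (fun i w => _) in gZ.
have mF := measurableT_comp mphi (@measurable_sqdet_cmx r.+1 t.+1).
rewrite (gaussian_law gX gZ mF (fun f => phi0 _)).
have mZ : @measurable_fun _ _ (T * T)%type (@vectors R ('I_r.+1 * 'I_t.+1 * bool)%type) setT (fun w i => Z i w).
  by apply: measurable_vectorP => i; exact: gZ.1.
apply: (eq_trans (@fubini_tonelli1 _ _ T T R P P _ (measurableT_comp mF mZ) (fun f => phi0 _))).
pose Xm (k : 'I_r * 'I_t * bool) := X (lift ord0 k.1.1, lift ord0 k.1.2, k.2).
pose X0 (k : 'I_r.+1 * bool) := X (k.1, ord0, k.2).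
pose XB (k : 'I_r.+1 * 'I_t * bool) := X (k.1.1, lift ord0 k.1.2, k.2).
have gXm : gaussian_on P predT Xm by exact: gaussian_on_minor.
have gX0 : gaussian_on P predT X0.
  apply: (gaussian_on_inj (s := fun k : 'I_r.+1 * bool => (k.1, ord0, k.2)) _ _ gX) => //.
  by move=> [i b] [i' b'] [] /= -> ->.
have gXB : gaussian_on P predT XB.
  apply: (gaussian_on_inj (s := fun k : 'I_r.+1 * 'I_t * bool => (k.1.1, lift ord0 k.1.2, k.2)) _ _ gX) => //.
  by move=> [[i j] b] [[i' j'] b'] [] /= -> e2 ->; congr (_, _, _); apply/ord_inj.
have mXm := measurable_sqdet_gaussian gXm.
pose g (x : R) := \int[P]_w phi (x * sqdet (cmx (fun k => Xm k w)))%R.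
have g0 x : 0 <= g x by apply: integral_ge0.
have mg : measurable_fun setT g.
  have mh : measurable_fun setT (fun z : measurableTypeR R * T => phi (z.1 * sqdet (cmx (fun k => Xm k z.2)))%R).
    apply: (measurableT_comp mphi).
    apply: measurable_funM; first exact: measurable_fst.
    exact: (measurableT_comp mXm measurable_snd).
  exact: (@measurable_fun_fubini_tonelli_F _ _ (measurableTypeR R) T R P _ mh (fun z => phi0 _)).
rewrite -[RHS](ge0_integral_gaussian_sqnorm gX0 mg g0).
apply: eq_integral => w1 _; rewrite /fubini_F /=.
pose y : 'cV[C]_r.+1 := \col_i (X (i, ord0, false) w1 +i* X (i, ord0, true) w1)%C.
(* [U] is picked for one frozen [w1] and is gone from the integral before [w1] varies, so no
   measurable selection arises. *)
have [U iU [x xy Uy]] := isotropic_to_axis P y.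
have -> : (\sum_(i < r.+1) (X0 (i, false) w1 ^+ 2 + X0 (i, true) w1 ^+ 2) = sqnorm y)%R.
  by apply: eq_bigr => i _; rewrite mxE.
(* The rows below the first of the rotated remaining columns; by isotropy they have the law of the
   minor [Xm]. *)
pose W (k : 'I_r * 'I_t * bool) := left_action U XB (lift ord0 k.1.1, k.1.2, k.2).
have gW : gaussian_on P predT W.
  apply: (gaussian_on_inj (s := fun k : 'I_r * 'I_t * bool => (lift ord0 k.1.1, k.1.2, k.2)) _ _ (iU.2 _ _ gXB)) => //.
  by move=> [[i j] b] [[i' j'] b'] [] /= e1 -> ->; congr (_, _, _); apply/ord_inj.
transitivity (\int[P]_w phi (sqnorm y * sqdet (cmx (fun k => W k w)))%R).
  apply: eq_integral => w2 _; rewrite cmx_row_mx /Z/=.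
  rewrite (_ : (fun k => _) = fun k => XB k w2); last first.
    by apply/funext => -[[i j] b].
  by rewrite (sqdet_row_mx _ iU.1 Uy) xy cmx_dsubmx.
apply: (gaussian_law (F := fun f => phi (sqnorm y * sqdet (cmx f))%R) gW gXm) => //.
apply: (measurableT_comp mphi); apply: measurable_funM => //.
exact: measurable_sqdet_cmx.
Qed.

End determinant_recursion.

(** * Moments of the log-determinant *)

Section logdet_moments.
Context {R : realType}.
Local Notation mu := (@lebesgue_measure R).

(** The i-th factor is Gamma of shape r - i, and each summand is the digamma function at r - i; the
    summands of [logdet_var] are trigamma values. *)
Definition logdet_mean (r t : nat) : R := \sum_(i < t) (harm (r - i.+1) - euler_gamma R).

Definition logdet_var (r t : nat) : R :=
  \sum_(i < t) (pi ^+ 2 / 6 - \sum_(1 <= k < (r - i.+1).+1) k%:R ^- 2).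

Lemma logdet_meanS r t :
  logdet_mean r.+1 t.+1 = harm r - euler_gamma R + logdet_mean r t.
Proof.
by rewrite /logdet_mean big_ord_recl subn1; congr (_ + _); apply: eq_bigr => i _; rewrite subSS.
Qed.

Lemma logdet_varS r t :
  logdet_var r.+1 t.+1 = pi ^+ 2 / 6 - \sum_(1 <= k < r.+1) k%:R ^- 2 + logdet_var r t.
Proof.
by rewrite /logdet_var big_ord_recl subn1; congr (_ + _); apply: eq_bigr => i _; rewrite subSS.
Qed.

Lemma measurable_le0 d (T : measurableType d) (D : T -> R) :
  measurable_fun setT D -> measurable [set w | D w <= 0].
Proof.
move=> mD; rewrite (_ : [set w | _] = D @^-1` `]-oo, 0]%classic); last first.
  by apply/seteqP; split => w; rewrite /= in_itv.
by rewrite -[X in measurable X]setTI; apply: mD => //; exact: measurable_itv.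
Qed.

Lemma sqdet_0cols r (A : 'M[R[i]]_(r, 0)) : sqdet A = 1.
Proof. by rewrite /sqdet det_mx00. Qed.

Local Open Scope ereal_scope.

Lemma logdet_moments r t d (T : measurableType d) (P : probability T R)
    (X : 'I_r * 'I_t * bool -> T -> R) :
  (t <= r)%N -> gaussian_on P predT X ->
  P [set w | sqdet (cmx (fun k => X k w)) <= 0]%R = 0 /\
  forall a : R, \int[P]_w ((ln (sqdet (cmx (fun k => X k w))) - a) ^+ 2)%:E =
    (logdet_var r t + (logdet_mean r t - a) ^+ 2)%:E.
Proof.
elim: t r X => [|t IH] r X.
  move=> _ _; split.
    rewrite (_ : [set _ | _] = set0) ?measure0//.
    by apply/seteqP; split => w //=; rewrite sqdet_0cols ler10.
  move=> a; under eq_integral do rewrite sqdet_0cols ln1.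
  rewrite integral_cst//=.
  by rewrite probability_setT mule1 /logdet_var /logdet_mean !big_ord0 !add0r.
case: r X => [|r] X //.
rewrite ltnS => tr gX.
pose Xm (k : 'I_r * 'I_t * bool) := X (lift ord0 k.1.1, lift ord0 k.1.2, k.2).
have gXm : gaussian_on P predT Xm by exact: gaussian_on_minor.
have [Pm Em] := IH r Xm tr gXm.
pose D w := sqdet (cmx (fun k => Xm k w)).
have mD : measurable_fun setT D := measurable_sqdet_gaussian gXm.
have mX := measurable_sqdet_gaussian gX.
split=> [|a].
  (* The recursion is applied to the indicator of this half-line: for x > 0, x * D is nonpositive
     exactly when D is. *)
  pose S : set R := `]-oo, 0%R]%classic.
  have mI : measurable_fun setT (fun s : R => (\1_S s)%:E : \bar R).
    by apply/measurable_EFinP; apply: measurable_indic; exact: measurable_itv.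
  have indicS (Q : T -> R) : measurable_fun setT Q ->
      P [set w | (Q w <= 0)%R] = \int[P]_w (\1_S (Q w))%:E.
    move=> mQ; rewrite -(setIT [set w | _]).
    rewrite (_ : [set w | (Q w <= 0)%R] = Q @^-1` S); last first.
      by apply/seteqP; split => w; rewrite /S /= in_itv.
    rewrite -integral_indic//.
    by rewrite -[X in measurable X]setTI; apply: mQ => //; exact: measurable_itv.
  rewrite indicS// (ge0_integral_sqdetS gX mI (fun s => _)); last by move=> s; rewrite lee_fin.
  apply: integral0_eq => x; rewrite /= in_itv/= andbT => x0.
  rewrite -indicS; last exact: measurable_funM.
  rewrite (_ : [set w | _] = [set w | (D w <= 0)%R]) ?Pm ?mul0e//.
  by apply/seteqP; split => w /=; rewrite pmulr_rle0.
(* Read off from the induction hypothesis at a = [logdet_mean r t], where the right side is the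
   variance alone. *)
have v0 : (0 <= logdet_var r t)%R.
  rewrite -lee_fin; have := Em (logdet_mean r t); rewrite subrr expr0n addr0 => <-.
  by apply: integral_ge0 => w _; rewrite lee_fin sqr_ge0.
rewrite (ge0_integral_sqdetS gX (measurable_lnsq a)); last by move=> s; rewrite lee_fin sqr_ge0.
rewrite logdet_meanS logdet_varS.
transitivity (\int[mu]_(x in `]0%R, +oo[)
    ((logdet_var r t + (ln x - (a - logdet_mean r t)) ^+ 2)%:E * (gamma_pdf r x)%:E)).
  apply: eq_integral => x; rewrite inE/= in_itv/= andbT => x0; congr (_ * _).
  (* Given the first factor [x], the target moves to a - ln x, which the induction hypothesis
     allows; its value is again a square in ln x, now about a - [logdet_mean r t]. *)
  transitivity (\int[P]_w ((ln (D w) - (a - ln x)) ^+ 2)%:E); last first.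
    by rewrite Em; congr (_ + _ ^+ 2)%:E; ring.
  apply: ae_eq_integral => //.
  - apply: (measurableT_comp (measurable_lnsq a)); exact: measurable_funM.
  - exact: (measurableT_comp (measurable_lnsq _) mD).
  - exists [set w | (D w <= 0)%R]; split; [exact: measurable_le0|exact: Pm|].
    move=> w /=; apply: contra_notP => /negP; rewrite -ltNge => Dw _.
    by rewrite lnM//; congr (_ ^+ 2)%:E; ring.
by rewrite (integral_ln_gammaD _ _ v0); congr _%:E; ring.
Qed.

End logdet_moments.

(** Count multiplicities: the term of index p <= n occurs in all t partial sums, and that of index p
    > n in n + t - p of them. *)
Lemma sum_partial_sums (R : comRingType) (u : nat -> R) n t :
  \sum_(i < t) \sum_(1 <= k < (n + t - i.+1).+1) u k =
  t%:R * \sum_(1 <= p < n.+1) u p + \sum_(n.+1 <= p < n + t) (n + t - p)%:R * u p.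
Proof.
elim: t => [|t IH]; first by rewrite big_ord0 mul0r big_geq ?addr0// addn0.
rewrite big_ord_recl addnS subn1/=.
rewrite [X in _ + X = _](_ : _ = \sum_(i < t) \sum_(1 <= k < (n + t - i.+1).+1) u k);
  last by apply: eq_bigr => i _; rewrite subSS.
rewrite IH [in LHS](@big_cat_nat _ _ _ n.+1 1 (n + t).+1)//=; last by rewrite ltnS leq_addr.
rewrite -[t.+1]addn1 natrD mulrDl mul1r.
have -> : \sum_(n.+1 <= p < (n + t).+1) ((n + t).+1 - p)%:R * u p =
    \sum_(n.+1 <= p < n + t) (n + t - p)%:R * u p + \sum_(n.+1 <= p < (n + t).+1) u p.
  case: t {IH} => [|t]; first by rewrite !addn0 !big_geq ?addr0.
  (* The added last term has coefficient 0, so both ranges can be made equal. *)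
  have <- : \sum_(n.+1 <= p < (n + t.+1).+1) (n + t.+1 - p)%:R * u p =
      \sum_(n.+1 <= p < n + t.+1) (n + t.+1 - p)%:R * u p.
    by rewrite big_nat_recr/= ?subnn ?mul0r ?addr0// addnS ltnS leq_addr.
  rewrite -big_split/=; apply: eq_big_nat => p /andP[_ pn].
  by rewrite subSn// -natr1 mulrDl mul1r.
by ring.
Qed.

Section moments.
Context {R : realType} d (T : measurableType d) (P : probability T R).
Local Open Scope ereal_scope.

(** The value at a = 0 gives square integrability, its difference with the value at a = 1 is 2 E L -
    1 and gives the mean, and a = m gives the variance. *)
Lemma moments_of_sqdist (L : T -> R) (m v : R) : measurable_fun setT L ->
  (forall a : R, \int[P]_w ((L w - a) ^+ 2)%:E = (v + (m - a) ^+ 2)%:E) ->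
  [/\ L \in Lfun P 2%:E, 'E_P[L] = m%:E & 'V_P[L] = v%:E].
Proof.
move=> mL Ea.
have L2 : L \in Lfun P 2%:E.
  rewrite inE; apply/andP; split; rewrite inE//= /finite_norm unlock poweR_lty//.
  rewrite (_ : \int[P]_w _ = (v + (m - 0) ^+ 2)%:E) ?ltry// -Ea.
  apply: eq_integral => w _; rewrite subr0.
by congr _%:E; rewrite powR_mulrn// real_normK ?num_real.
have L1 : L \in Lfun P 1 := Lfun_subset12 (fin_num_measure P _ measurableT) L2.
have Sq a : (fun w => (L w - a) ^+ 2)%R \in Lfun P 1.
  apply/Lfun1_integrable/integrableP; split.
    apply/measurable_EFinP; apply: measurable_funX; exact: measurable_funB.
  under eq_integral do rewrite /= ger0_norm ?sqr_ge0//.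
  by rewrite Ea ltry.
have EL : 'E_P[L] = m%:E.
  have e1 : 'E_P[(fun w => (L w - 0) ^+ 2)%R \- (fun w => (L w - 1) ^+ 2)%R] = (m *+ 2 - 1)%:E.
    rewrite expectationB//; rewrite unlock !Ea -EFinB; congr _%:E; ring.
  have e2 : 'E_P[(fun w => (L w - 0) ^+ 2)%R \- (fun w => (L w - 1) ^+ 2)%R] = 2%:E * 'E_P[L] - 1.
    rewrite -expectationZl// -[X in _ - X](expectation_cst P) -expectationB//.
    - by congr ('E_P[_]); apply/funext => w /=; ring.
    - exact: Lfun_scale.
    - exact: Lfun_cst.
  move: e2; rewrite e1 -(fineK (expectation_fin_num L1)).
  by rewrite -EFinM -EFinB => -[h]; congr _%:E; lra.
split=> //; rewrite /variance unlock EL/= unlock.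
by have := Ea m; rewrite subrr expr0n addr0 => <-; apply: eq_integral => w _; rewrite expr2.
Qed.

End moments.

Lemma logdet_meanE (R : realType) (r t : nat) : (1 <= t)%N -> (t <= r)%N ->
  logdet_mean r t = - euler_gamma R * t%:R + 1 - t%:R
         + t%:R * \sum_(1 <= p < (r - t).+1) (p%:R)^-1
         + r%:R * \sum_(r - t + 1 <= p < r) (p%:R)^-1.
Proof.
move=> t1 tr; rewrite /logdet_mean big_split/= sumr_const card_ord.
have := sum_partial_sums (fun k => k%:R^-1 : R) (r - t) t; rewrite (subnK tr) => ->.
(* (r - p) / p = r / p - 1, summed over t - 1 indices: the origin of 1 - t in the formula. *)
rewrite addn1 (_ : \sum_(_ <= p < r) (r - p)%:R * p%:R^-1 =
    r%:R * \sum_((r - t).+1 <= p < r) p%:R^-1 - (t%:R - 1)).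
  by rewrite -[_ *+ t]mulr_natr; ring.
rewrite mulr_sumr -(natrB _ t1) (_ : (t - 1)%N = (r - (r - t).+1)%N); last first.
  by rewrite [RHS]subnS subKn// subn1.
rewrite -[X in _ - X%:R]muln1 -sum_nat_const_nat natr_sum -sumrB.
apply: eq_big_nat => p /andP[p1 pr].
have p0 : p%:R != 0 :> R by rewrite pnatr_eq0 -lt0n (leq_ltn_trans _ p1).
by rewrite natrB 1?ltnW// mulrBl divff.
Qed.

Lemma logdet_varE (R : realType) (r t : nat) : (t <= r)%N ->
  logdet_var r t = pi ^+ 2 * t%:R / 6%:R
         - t%:R * \sum_(1 <= p < (r - t).+1) (p%:R ^+ 2)^-1
         - \sum_(r - t + 1 <= p < r) (r - p)%:R / p%:R ^+ 2 :> R.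
Proof.
move=> tr; rewrite /logdet_var sumrB sumr_const card_ord.
have := sum_partial_sums (fun k => k%:R ^- 2 : R) (r - t) t; rewrite (subnK tr) => ->.
by rewrite addn1 -[_ *+ t]mulr_natr opprD addrA mulrAC.
Qed.

Unset Implicit Arguments.

Theorem theorem5p4 (R : realType) (d : measure_display) (T : measurableType d)
  (P : probability T R) (r t : nat) (sigma2 : R)
  (X : 'I_r -> 'I_t -> bool -> T -> R) :
  (1 <= t)%N -> (t <= r)%N -> 0 < sigma2 ->
  (forall i j b, measurable_fun setT (X i j b)) ->
  (forall i j b (A : set R), measurable A ->
     P (X i j b @^-1` A) = normal_prob 0 (Num.sqrt (2^-1)) A) ->
  mutually_independent P (fun k : 'I_r * 'I_t * bool => X k.1.1 k.1.2 k.2) ->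
  let H := cmatrix X in
  let L := fun w => lndet (ctrmx (H w) *m H w) in
  let delta := fun w =>
    lndet (((pi * expR 1 * sigma2)^-1)%:C%C *: (ctrmx (H w) *m H w)) in
  [/\ L \in Lfun P 2%:E,
      ('E_P[delta])%E =
        (- euler_gamma R * t%:R + 1 - t%:R
         + t%:R * \sum_(1 <= p < (r - t).+1) (p%:R)^-1
         + r%:R * \sum_(r - t + 1 <= p < r) (p%:R)^-1
         - t%:R * ln (pi * expR 1 * sigma2))%:E
    & ((t%:R)%:E + variance P L)%E =
        (t%:R + pi ^+ 2 * t%:R / 6%:R
         - t%:R * \sum_(1 <= p < (r - t).+1) (p%:R ^+ 2)^-1
         - \sum_(r - t + 1 <= p < r) (r - p)%:R / p%:R ^+ 2)%:E].
Proof.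
move=> t1 tr s0 mX NX indX H L delta.
pose Y (k : 'I_r * 'I_t * bool) := X k.1.1 k.1.2 k.2.
have gY : gaussian_on P predT Y.
  split=> [k _|B mB]; first exact: mX.
  transitivity (P (\bigcap_(k in [set: 'I_r * 'I_t * bool]) (Y k @^-1` B k))).
    by congr (P _); apply/seteqP; split => w h k _; exact: h.
  by rewrite indX//; apply: eq_bigr => k _; exact: NX.
pose D w := sqdet (cmx (fun k => Y k w)).
have HD w : complex.Re (\det (ctrmx (H w) *m H w)) = D w.
  by rewrite /D /sqdet; congr (complex.Re (\det (ctrmx _ *m _))); apply/matrixP => i j; rewrite !mxE.
have mD : measurable_fun setT D := measurable_sqdet_gaussian gY.
have [D0 DE] := logdet_moments tr gY.
have LE : L = fun w => ln (D w) by apply/funext => w; rewrite /L /lndet HD.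
have mL : measurable_fun setT L by rewrite LE; exact: measurableT_comp.
have [L2 EL VL] : [/\ L \in Lfun P 2%:E, ('E_P[L] = (logdet_mean r t)%:E)%E
    & ('V_P[L] = (logdet_var r t)%:E)%E].
  by apply: moments_of_sqdist => // a; rewrite -DE LE.
have L1 : L \in Lfun P 1 := Lfun_subset12 (fin_num_measure P _ measurableT) L2.
split=> //; last by rewrite VL logdet_varE// -EFinD !addrA.
set c : R := pi * expR 1 * sigma2.
have c0 : 0 < c by rewrite !mulr_gt0 ?pi_gt0 ?expR_gt0.
have dE w : delta w = ln (c^-1 ^+ t * D w).
  rewrite /delta /lndet -/c detZ -HD -rmorphXn.
  by set z := \det _; case: z => a b /=; rewrite mul0r subr0.
(* [delta] equals [L] minus t ln c only where D > 0, since the logarithm of the product has to be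
   split; off that set the two are compared up to a null set. *)
pose K : T -> R := L \+ cst (- (t%:R * ln c)).
transitivity ('E_P[K])%E; last first.
  by rewrite /K expectationD ?Lfun_cst// EL expectation_cst -EFinD logdet_meanE.
rewrite unlock; apply: ae_eq_integral => //.
- apply/measurable_EFinP; rewrite (_ : delta = @ln R \o (fun w => c^-1 ^+ t * D w)); last exact/funext.
  by apply: measurableT_comp => //; exact: measurable_funM.
- by apply/measurable_EFinP; exact: measurable_funD.
- exists [set w | D w <= 0]; split; [exact: measurable_le0|exact: D0|].
  move=> w /=; apply: contra_notP => /negP; rewrite -ltNge => Dw _.
  rewrite dE /K LE /= lnM ?posrE ?exprn_gt0 ?invr_gt0// lnXn ?invr_gt0// lnV ?posrE//.
  by congr _%:E; rewrite -[_ *+ t]mulr_natl; ring.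
Qed.
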